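(* Let $n\ge 1$ and $d$ be integers and let $k$ be an algebraically closed field of characteristic zero or greater than $d$. Let $P=k_{dp}[x_1,\dots,x_n]$ and consider the set $\mathcal G\subset P_{\le d}$ of dual socle generators of canonically graded algebras of socle degree $d$, i.e. the set of $f\in P_{\le d}$ of degree $d$ such that $\operatorname{Apolar}(f)\simeq\operatorname{gr}\operatorname{Apolar}(f)$. Then $\mathcal G$ is irreducible and constructible (in the Zariski topology of the affine space $P_{\le d}$), but in general it is neither open nor closed: there exist integers $n\ge 1$ and $d$ and an algebraically closed field $k$ of characteristic zero or greater than $d$ for which $\mathcal G$ is not closed in $P_{\le d}$, and there exist integers $n\ge 1$ and $d$ and an algebraically closed field $k$ of characteristic zero or greater than $d$ for which $\mathcal G$ is not open in $P_{\le d}$.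
   Context: Let $S=k[[\alpha_1,\dots,\alpha_n]]$. $P=k_{dp}[x_1,\dots,x_n]$ is the divided power ring, with $k$-basis the monomials $\mathbf x^{[\mathbf a]}$, $\mathbf a\in\mathbb N_0^n$ (of degree $\sum a_i$), $P_{\le d}$ is the span of those of degree at most $d$, and $S$ acts on $P$ by contraction: $\alpha^{\mathbf a}\lrcorner \mathbf x^{[\mathbf b]}=\mathbf x^{[\mathbf b-\mathbf a]}$ if $\mathbf b\ge\mathbf a$ coordinatewise and $0$ otherwise. For $f\in P$, $\operatorname{Apolar}(f)=S/\operatorname{Ann}(f)$ with $\operatorname{Ann}(f)=\{\sigma\in S:\sigma\lrcorner f=0\}$; if $A\simeq\operatorname{Apolar}(f)$ then $f$ is called a dual socle generator of $A$, and the socle degree of $A$ is $\deg f$. For a local algebra $(A,\mathfrak m_A)$, $\operatorname{gr}A=\bigoplus_{i}\mathfrak m_A^i/\mathfrak m_A^{i+1}$; $A$ is canonically graded if $A\simeq\operatorname{gr}A$. *)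

(* Defs.v *)
From HB Require Import structures.
From mathcomp Require Import all_boot all_order all_algebra.
From mathcomp Require Import boolp classical_sets.
From mathcomp Require Import mpoly.

Set Implicit Arguments.
Unset Strict Implicit.
Unset Printing Implicit Defensive.

Import GRing.Theory.

Local Open Scope ring_scope.
Local Open Scope quotient_scope.

(* [PSeries s] is the power series  \sum_a s(a) alpha^a  in
   k[[alpha_1, ..., alpha_n]]. *)
Record pseries (n : nat) (k : Type) := PSeries { pscoef :> 'X_{1..n} -> k }.

HB.instance Definition _ n k := gen_eqMixin (pseries n k).
HB.instance Definition _ n k := gen_choiceMixin (pseries n k).

Section PowerSeries.
Variables (n : nat) (k : comNzRingType).
Implicit Types s t u : pseries n k.

Lemma pseriesP s t : (forall m, s m = t m) -> s = t.
Proof. by case: s t => [s] [t] /= /funext ->. Qed.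

Definition ps_zero : pseries n k := PSeries (fun=> 0).
Definition ps_opp s := PSeries (fun m => - s m).
Definition ps_add s t := PSeries (fun m => s m + t m).

Lemma ps_addA : associative ps_add.
Proof. by move=> s t u; apply: pseriesP => m /=; rewrite addrA. Qed.
Lemma ps_addC : commutative ps_add.
Proof. by move=> s t; apply: pseriesP => m /=; rewrite addrC. Qed.
Lemma ps_add0 : left_id ps_zero ps_add.
Proof. by move=> s; apply: pseriesP => m /=; rewrite add0r. Qed.
Lemma ps_addN : left_inverse ps_zero ps_opp ps_add.
Proof. by move=> s; apply: pseriesP => m /=; rewrite addNr. Qed.

HB.instance Definition _ :=
  GRing.isZmodule.Build (pseries n k) ps_addA ps_addC ps_add0 ps_addN.

Definition ps_one : pseries n k := PSeries (fun m => (m == 0%MM)%:R).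

Definition ps_mul s t : pseries n k := PSeries (fun m =>
  \sum_(ab : 'X_{1..n < (mdeg m).+1, (mdeg m).+1} | m == (ab.1 + ab.2)%MM)
     s ab.1 * t ab.2).

Definition ps_trunc (d : nat) s : {mpoly k[n]} :=
  \sum_(m : 'X_{1..n < d}) s m *: 'X_[m].

Lemma ps_truncE d s m : (mdeg m < d)%N -> (ps_trunc d s)@_m = s m.
Proof. exact: mcoeff_mpoly. Qed.

Lemma ps_mul_trunc d s t m : (mdeg m < d)%N ->
  ps_mul s t m = (ps_trunc d s * ps_trunc d t)@_m.
Proof.
move=> md; rewrite mcoeffM /=; apply: eq_bigr => -[a b] /= /eqP /(congr1 mdeg).
rewrite mdegD => mE; rewrite !ps_truncE //; apply: leq_ltn_trans md.
  exact: leq_trans (leq_addl _ _) (eq_leq (esym mE)).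
exact: leq_trans (leq_addr _ _) (eq_leq (esym mE)).
Qed.

Lemma ps_trunc_mul d s t m : (mdeg m < d)%N ->
  (ps_trunc d (ps_mul s t))@_m = (ps_trunc d s * ps_trunc d t)@_m.
Proof. by move=> md; rewrite ps_truncE // (ps_mul_trunc _ _ md). Qed.

Lemma mcoeffM_eq (p p' q q' : {mpoly k[n]}) m :
    (forall a, (mdeg a <= mdeg m)%N -> p@_a = p'@_a) ->
    (forall a, (mdeg a <= mdeg m)%N -> q@_a = q'@_a) ->
  (p * q)@_m = (p' * q')@_m.
Proof.
move=> ep eq; rewrite !mcoeffM; apply: eq_bigr => -[a b] /= /eqP /(congr1 mdeg).
rewrite mdegD => mE; rewrite ep ?eq //.
  exact: leq_trans (leq_addl _ _) (eq_leq (esym mE)).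
exact: leq_trans (leq_addr _ _) (eq_leq (esym mE)).
Qed.

Lemma ps_mulA : associative ps_mul.
Proof.
move=> s t u; apply: pseriesP => m; pose d := (mdeg m).+1.
rewrite !(@ps_mul_trunc d) //.
transitivity ((ps_trunc d s * (ps_trunc d t * ps_trunc d u))@_m).
  by apply: mcoeffM_eq => // a am; rewrite ps_trunc_mul.
rewrite mulrA; apply: mcoeffM_eq => // a am.
by rewrite ps_trunc_mul.
Qed.

Lemma ps_mulC : commutative ps_mul.
Proof.
by move=> s t; apply: pseriesP => m; rewrite !(@ps_mul_trunc (mdeg m).+1) // mulrC.
Qed.

Lemma ps_mul1 : left_id ps_one ps_mul.
Proof.
move=> s; apply: pseriesP => m; pose d := (mdeg m).+1.
rewrite (@ps_mul_trunc d) // -[RHS](@ps_truncE d) // -[in RHS](mul1r (ps_trunc d s)).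
by apply: mcoeffM_eq => // a am; rewrite ps_truncE // mcoeff1.
Qed.

Lemma ps_mulDl : left_distributive ps_mul ps_add.
Proof.
move=> s t u; apply: pseriesP => m /=; rewrite -big_split /=.
by apply: eq_bigr => a _; rewrite mulrDl.
Qed.

Lemma ps_one_neq0 : ps_one != 0.
Proof.
apply/eqP => /(congr1 (fun s : pseries n k => s 0%MM)) /= /eqP.
by rewrite eqxx oner_eq0.
Qed.

HB.instance Definition _ := GRing.Zmodule_isComNzRing.Build (pseries n k)
  ps_mulA ps_mulC ps_mul1 ps_mulDl ps_one_neq0.

Definition ps_scale (c : k) s : pseries n k := PSeries (fun m => c * s m).

Lemma ps_scaleA a b s : ps_scale a (ps_scale b s) = ps_scale (a * b) s.
Proof. by apply: pseriesP => m /=; rewrite mulrA. Qed.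
Lemma ps_scale1 : left_id 1 ps_scale.
Proof. by move=> s; apply: pseriesP => m /=; rewrite mul1r. Qed.
Lemma ps_scaleDr : right_distributive ps_scale +%R.
Proof. by move=> c s t; apply: pseriesP => m /=; rewrite mulrDr. Qed.
Lemma ps_scaleDl s : {morph ps_scale^~ s : a b / a + b}.
Proof. by move=> a b; apply: pseriesP => m /=; rewrite mulrDl. Qed.

HB.instance Definition _ := GRing.Zmodule_isLmodule.Build k (pseries n k)
  ps_scaleA ps_scale1 ps_scaleDr ps_scaleDl.

Lemma ps_scaleAl (c : k) s t : c *: (s * t) = (c *: s) * t.
Proof.
apply: pseriesP => m /=; rewrite mulr_sumr.
by apply: eq_bigr => a _; rewrite mulrA.
Qed.

HB.instance Definition _ :=
  GRing.Lmodule_isLalgebra.Build k (pseries n k) ps_scaleAl.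
HB.instance Definition _ := GRing.Lalgebra_isComAlgebra.Build k (pseries n k).

End PowerSeries.

(* Carrier of k_dp[x_1, ..., x_n].  Only the k-module structure and the degree
   matter here.  As a k-module it is free on the divided monomials x^[a], and it is
   represented by {mpoly k[n]}, with 'X_[a] standing for x^[a].  The ring
   product of {mpoly k[n]} is not the divided power product; it is never
   applied to elements of [dpoly]. *)
Definition dpoly (n : nat) (k : comNzRingType) := {mpoly k[n]}.

Section Contraction.
Variables (n : nat) (k : comNzRingType).
Implicit Types (s t : pseries n k) (f : dpoly n k).

(* The sum over [a] is finite since alpha^a kills x^[b] unless a <= b. *)
Definition contract s f : dpoly n k :=
  \sum_(b <- msupp f)
    \sum_(a : 'X_{1..n < (mdeg b).+1} | (a <= b)%MM) (s a * f@_b) *: 'X_[b - a].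

Lemma contract_coef s f m D : (msize f <= D)%N ->
  (contract s f)@_m = \sum_(a : 'X_{1..n < D}) s a * f@_(m + a).
Proof.
move=> fD; rewrite raddf_sum /=.
transitivity (\sum_(b <- msupp f) \sum_(a : 'X_{1..n < D})
    (if b == (m + a)%MM then s a * f@_b else 0)).
  rewrite [LHS]big_seq_cond [RHS]big_seq_cond.
  apply: eq_bigr => b; rewrite andbT => bf; rewrite raddf_sum /=.
  have bD : (mdeg b < D)%N by apply: leq_trans fD; exact: msize_mdeg_lt.
  case: (boolP (m <= b)%MM) => mb; last first.
    rewrite [RHS]big1 => [|a _]; last first.
      by case: eqP => // bE; rewrite bE lem_addr in mb.
    rewrite big1 // => a ab; rewrite mcoeffZ mcoeffX.
    case: eqP => [bE|_]; last by rewrite mulr0.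
    by rewrite -bE lem_subr in mb.
  have dE : (mdeg (b - m)%MM <= mdeg b)%N.
    by rewrite -{2}(submK mb) mdegD leq_addr.
  rewrite (bigD1 (BMultinom (dE : mdeg _ < (mdeg b).+1)%N)) /=; last exact: lem_subr.
  rewrite [RHS](bigD1 (BMultinom (leq_ltn_trans dE bD))) //=.
  have -> : (b - (b - m))%MM = m.
    by apply/mnmP => i; rewrite !mnmBE subKn //; move/mnm_lepP: mb.
  rewrite mcoeffZ mcoeffX eqxx mulr1 addmC submK // eqxx.
  congr (_ + _); rewrite !big1 // => a.
    move=> neq; case: eqP => // bE; case/negP: neq.
    by apply/eqP/val_inj => /=; rewrite bE addmC addmK.
  case/andP => ab neq; rewrite mcoeffZ mcoeffX.
  case: eqP => [bE|_]; last by rewrite mulr0.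
  case/negP: neq; apply/eqP/val_inj => /=.
  by apply/mnmP => i; rewrite -bE !mnmBE subKn //; move/mnm_lepP: ab.
rewrite exchange_big /=; apply: eq_bigr => a _.
rewrite -big_mkcond /=; case: (boolP ((m + a)%MM \in msupp f)) => maf.
  by rewrite -big_filter filter_pred1_uniq ?msupp_uniq // big_seq1.
rewrite (memN_msupp_eq0 maf) mulr0 big_seq_cond big1 // => b.
by case/andP => bf /eqP bE; rewrite -bE bf in maf.
Qed.

Lemma contract0l f : contract 0 f = 0.
Proof.
by apply/mpolyP => m; rewrite (contract_coef _ _ (leqnn _)) mcoeff0 big1 // => a _;
  rewrite mul0r.
Qed.

Lemma contract0r s : contract s 0 = 0.
Proof. by rewrite /contract msupp0 big_nil. Qed.

Lemma contractDl s t f : contract (s + t) f = contract s f + contract t f.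
Proof.
apply/mpolyP => m; rewrite mcoeffD !(contract_coef _ _ (leqnn _)) -big_split.
by apply: eq_bigr => a _; rewrite mulrDl.
Qed.

Lemma contract1 f : contract 1 f = f.
Proof.
apply/mpolyP => m; have [->|f0] := eqVneq f 0; first by rewrite contract0r.
have D0 : (mdeg (0%MM : 'X_{1..n}) < msize f)%N.
  by rewrite mdeg0 lt0n msize_poly_eq0.
rewrite (contract_coef _ _ (leqnn _)) (bigD1 (BMultinom D0)) //=.
rewrite eqxx mul1r addm0 big1 ?addr0 // => a aN0; rewrite /= -[X in _ * X]mul1r.
by rewrite (_ : (a == 0%MM :> 'X_{1..n}) = false) ?mul0r //; apply/negbTE.
Qed.

Lemma contractM s t f : contract (s * t) f = contract s (contract t f).
Proof.
apply/mpolyP => m; set D := maxn (msize f) (msize (contract t f)).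
rewrite !(@contract_coef _ _ m D) ?leq_maxl ?leq_maxr //.
transitivity (\sum_(c : 'X_{1..n < D}) \sum_(ab : 'X_{1..n < D, D} |
    (val c == (ab.1 + ab.2)%MM)) s ab.1 * t ab.2 * f@_(m + c)).
  apply: eq_bigr => c _; rewrite -mulr_suml; congr (_ * _).
  rewrite [LHS](ps_mul_trunc s t (bmdeg c)) (mcoeff_poly_mul _ _ (bmdeg c)).
  by apply: eq_bigr => ab _; rewrite !ps_truncE ?bmdeg.
rewrite (exchange_big_dep xpredT) //= -(pair_bigA _ (fun a b : 'X_{1..n < D} =>
  \sum_(c : 'X_{1..n < D} | val c == (a + b)%MM) s a * t b * f@_(m + c))) /=.
apply: eq_bigr => a _; rewrite (@contract_coef _ _ _ D) ?leq_maxl // mulr_sumr.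
apply: eq_bigr => b _; rewrite mulrA -addmA.
case: (ltnP (mdeg (a + b)%MM) D) => abD.
  rewrite (bigD1 (BMultinom abD)) //= big1 ?addr0 // => c /andP[/eqP ce].
  by case/eqP; exact: val_inj.
rewrite big1 => [|c /eqP ce]; last by have := bmdeg c; rewrite ce ltnNge abD.
rewrite (_ : f@_ _ = 0) ?mulr0 //; apply/memN_msupp_eq0.
apply/negP => /msize_mdeg_lt; rewrite ltnNge => /negP; apply.
by rewrite mdegD (leq_trans _ (leq_trans abD (leq_addl _ _))) // leq_maxl.
Qed.

End Contraction.

Section IdealQuotAlgebra.
Variables (k : comNzRingType) (R : comAlgType k) (I : idealr R).

Definition quot_scale (c : k) (x : {ideal_quot I}) : {ideal_quot I} :=
  \pi_{ideal_quot I} (c%:A) * x.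

Lemma quot_scaleA a b x : quot_scale a (quot_scale b x) = quot_scale (a * b) x.
Proof. by rewrite /quot_scale mulrA -rmorphM /= -scalerAl mul1r scalerA. Qed.
Lemma quot_scale1 : left_id 1 quot_scale.
Proof. by move=> x; rewrite /quot_scale scale1r rmorph1 mul1r. Qed.
Lemma quot_scaleDr : right_distributive quot_scale +%R.
Proof. by move=> c x y; rewrite /quot_scale mulrDr. Qed.
Lemma quot_scaleDl x : {morph quot_scale^~ x : a b / a + b}.
Proof. by move=> a b; rewrite /quot_scale scalerDl rmorphD mulrDl. Qed.

HB.instance Definition _ := GRing.Zmodule_isLmodule.Build k {ideal_quot I}
  quot_scaleA quot_scale1 quot_scaleDr quot_scaleDl.

Lemma quot_scaleAl (c : k) (x y : {ideal_quot I}) : c *: (x * y) = (c *: x) * y.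
Proof. exact: mulrA. Qed.

HB.instance Definition _ :=
  GRing.Lmodule_isLalgebra.Build k {ideal_quot I} quot_scaleAl.
HB.instance Definition _ := GRing.Lalgebra_isComAlgebra.Build k {ideal_quot I}.

End IdealQuotAlgebra.

Definition ann (n : nat) (k : comNzRingType) (f : dpoly n k) : pred (pseries n k) :=
  fun s => contract s f == 0.

Lemma ann_idealr_closed (n : nat) (k : comNzRingType) (f : dpoly n k) :
  f != 0 -> idealr_closed (ann f).
Proof.
move=> f0; split; rewrite ?unfold_in /ann.
- by rewrite contract0l.
- by rewrite contract1.
move=> a s t /eqP s0 /eqP t0; rewrite unfold_in contractDl contractM s0 t0.
by rewrite contract0r addr0.
Qed.

Definition ann_ideal (n : nat) (k : comNzRingType) (f : dpoly n k) (hf : f != 0)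
    : idealr (pseries n k) :=
  HB.pack (ann f) (isIdealr.Build _ _ (ann_idealr_closed hf)).

(* For f = 0 the quotient would be the zero ring; such an f has no degree. *)
Definition apolar (n : nat) (k : comNzRingType) (f : dpoly n k) (hf : f != 0)
    : comAlgType k :=
  {ideal_quot (ann_ideal hf)}.

Section IdealPowers.
Variables (A : comNzRingType).
Implicit Types (I J : set A).

Definition ideal_mul I J : set A := [set z | exists s : seq (A * A),
  (forall xy, xy \in s -> I xy.1 /\ J xy.2) /\ z = \sum_(xy <- s) xy.1 * xy.2].

Definition ideal_exp I (i : nat) : set A := iter i (ideal_mul I) setT.

Lemma ideal_exp0 I i : ideal_exp I i 0.
Proof. by case: i => // i; exists [::]; rewrite big_nil. Qed.

Lemma ideal_expD I i x y : ideal_exp I i x -> ideal_exp I i y -> ideal_exp I i (x + y).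
Proof.
case: i => // i [s [sI ->]] [t [tI ->]]; exists (s ++ t); rewrite big_cat; split=> //.
by move=> xy; rewrite mem_cat => /orP[/sI|/tI].
Qed.

Lemma ideal_exp_sum I i (T : Type) (r : seq T) (P : pred T) (F : T -> A) :
  (forall t, P t -> ideal_exp I i (F t)) -> ideal_exp I i (\sum_(t <- r | P t) F t).
Proof.
move=> H; elim/big_ind: _ => //; first exact: ideal_exp0.
by move=> x y; exact: ideal_expD.
Qed.

Lemma ideal_expMl I i a x : ideal_exp I i x -> ideal_exp I i (a * x).
Proof.
elim: i x a => // i IH x a [s [sI ->]].
exists [seq (xy.1, a * xy.2) | xy <- s]; split=> [xy /mapP[uv /sI[Iu Jv] ->]|].
  by split=> //=; exact: IH.
by rewrite big_map mulr_sumr; apply: eq_bigr => xy _ /=; rewrite mulrCA.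
Qed.

Lemma ideal_expN I i x : ideal_exp I i x -> ideal_exp I i (- x).
Proof. by rewrite -mulN1r; exact: ideal_expMl. Qed.

Lemma ideal_exp_mul I i j x y :
  ideal_exp I i x -> ideal_exp I j y -> ideal_exp I (i + j) (x * y).
Proof.
elim: i x y => [|i IH] x y; first by move=> _; exact: ideal_expMl.
move=> [s [sI ->]] Jy; exists [seq (uv.1, uv.2 * y) | uv <- s]; split.
  by move=> xy /mapP[uv /sI[Iu Jv] ->]; split=> //=; exact: IH.
by rewrite big_map mulr_suml; apply: eq_bigr => uv _ /=; rewrite mulrA.
Qed.

End IdealPowers.

(* gr_I A = (+)_i I^i / I^(i+1)  is the quotient of the subring
   (+)_i I^i T^i  of A[T] by the ideal  (+)_i I^(i+1) T^i. *)
Section AssociatedGraded.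
Variables (k : comNzRingType) (A : comAlgType k) (I : idealr A).

Local Notation pow := (ideal_exp [set x | x \in I]).

Definition rees_pred : pred {poly A} := fun p => `[< forall i, pow i p`_i >].

Lemma rees_subring_closed : subring_closed rees_pred.
Proof.
split=> [|p q /asboolP pP /asboolP qP|p q /asboolP pP /asboolP qP].
- by apply/asboolP => -[|i] //; rewrite coef1; exact: ideal_exp0.
- apply/asboolP => i; rewrite coefB; apply: ideal_expD => //.
  exact: ideal_expN.
- apply/asboolP => i; rewrite coefM; apply: ideal_exp_sum => j _.
  have ij : (j + (i - j))%N = i by rewrite subnKC // -ltnS.
  by have := ideal_exp_mul (pP j) (qP (i - j)%N); rewrite ij.
Qed.

HB.instance Definition _ :=
  GRing.isSubringClosed.Build {poly A} rees_pred rees_subring_closed.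

Record rees := Rees { rees_val :> {poly A}; _ : rees_val \in rees_pred }.

HB.instance Definition _ := [isSub for rees_val].
HB.instance Definition _ := [Choice of rees by <:].
HB.instance Definition _ := [SubChoice_isSubComNzRing of rees by <:].

Lemma rees_scale_subproof (c : k) (p : rees) : c%:A *: rees_val p \in rees_pred.
Proof.
apply/asboolP => i; rewrite coefZ; apply: ideal_expMl.
by case: p => p /= /asboolP.
Qed.

Definition rees_scale (c : k) (p : rees) : rees := Rees (rees_scale_subproof c p).

Lemma rees_scaleA a b p : rees_scale a (rees_scale b p) = rees_scale (a * b) p.
Proof. by apply: val_inj; rewrite /= scalerA -scalerAl mul1r scalerA. Qed.
Lemma rees_scale1 : left_id 1 rees_scale.
Proof. by move=> p; apply: val_inj; rewrite /= !scale1r. Qed.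
Lemma rees_scaleDr : right_distributive rees_scale +%R.
Proof. by move=> c p q; apply: val_inj; rewrite /= scalerDr. Qed.
Lemma rees_scaleDl p : {morph rees_scale^~ p : a b / a + b}.
Proof. by move=> a b; apply: val_inj; rewrite /= !scalerDl. Qed.

HB.instance Definition _ := GRing.Zmodule_isLmodule.Build k rees
  rees_scaleA rees_scale1 rees_scaleDr rees_scaleDl.

Lemma rees_scaleAl (c : k) (p q : rees) : c *: (p * q) = (c *: p) * q.
Proof. by apply: val_inj; rewrite /= scalerAl. Qed.

HB.instance Definition _ := GRing.Lmodule_isLalgebra.Build k rees rees_scaleAl.
HB.instance Definition _ := GRing.Lalgebra_isComAlgebra.Build k rees.

Definition rees_kernel : pred rees :=
  fun p => `[< forall i, pow i.+1 (rees_val p)`_i >].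

Lemma rees_kernel_idealr_closed : idealr_closed rees_kernel.
Proof.
split; first by apply/asboolP => i; rewrite coef0; exact: ideal_exp0.
  apply/negP => /asboolP /(_ 0%N); rewrite coef1 /= => -[s [sI e1]].
  have : 1 \in I.
    rewrite [1]e1; rewrite big_seq; apply: rpred_sum => xy xys.
    by rewrite mulrC idealMr //; case: (sI _ xys).
  by rewrite idealr1.
move=> [a aR] u v; have /asboolP aP := aR.
move=> /asboolP uP /asboolP vP; apply/asboolP => i.
rewrite coefD; apply: ideal_expD => //.
rewrite coefM; apply: ideal_exp_sum => j _.
have ij : (j + (i - j).+1)%N = i.+1 by rewrite addnS subnKC // -ltnS.
by have := ideal_exp_mul (aP j) (uP (i - j)%N); rewrite ij.
Qed.

HB.instance Definition _ :=
  isIdealr.Build rees rees_kernel rees_kernel_idealr_closed.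

Definition gr : comAlgType k := {ideal_quot (rees_kernel : idealr rees)}.

End AssociatedGraded.

Definition nonunits (A : comNzRingType) : pred A :=
  fun x => `[< ~ exists y : A, x * y = 1 >].
Arguments nonunits : clear implicits.

(* A nonzero commutative ring is local iff its non-units are closed under
   addition; its maximal ideal is then the set of non-units. *)
Definition local_ring (A : comNzRingType) : Prop :=
  forall x y : A, x \in nonunits A -> y \in nonunits A -> x + y \in nonunits A.

Lemma nonunits_idealr_closed (A : comNzRingType) :
  local_ring A -> idealr_closed (nonunits A).
Proof.
move=> hA; split.
- apply/asboolP => -[y]; rewrite mul0r => /esym/eqP.
  by rewrite oner_eq0.
- by apply/negP => /asboolP; apply; exists 1; rewrite mul1r.
move=> a u v /asboolP uN vN; apply: hA => //.
by apply/asboolP => -[y e]; apply: uN; exists (a * y); rewrite mulrCA mulrA.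
Qed.

Definition max_ideal (A : comNzRingType) (hA : local_ring A) : idealr A :=
  HB.pack (nonunits A) (isIdealr.Build _ _ (nonunits_idealr_closed hA)).

Definition alg_isomorphic (k : comNzRingType) (A B : comAlgType k) : Prop :=
  exists phi : {lrmorphism A -> B}, bijective phi.

Definition canonically_graded (k : comNzRingType) (A : comAlgType k) : Prop :=
  exists hA : local_ring A, alg_isomorphic A (gr (max_ideal hA)).

(* [msize f] is 1 + deg f, and 0 for f = 0 *)
Definition canonically_graded_generators (n d : nat) (k : comNzRingType)
    : set (dpoly n k) :=
  [set f | msize f = d.+1 /\ exists hf : f != 0, canonically_graded (apolar hf)].
Arguments canonically_graded_generators : clear implicits.

Section Zariski.
Variables (N : nat) (k : fieldType).
Implicit Types A U F : set 'rV[k]_N.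
Local Open Scope classical_set_scope.

Definition zariski_closed A : Prop :=
  exists E : set {mpoly k[N]}, A = [set v | forall p, E p -> p.@[v ord0] = 0].

Definition zariski_open A : Prop := zariski_closed (~` A).

Definition zariski_irreducible A : Prop :=
  A !=set0 /\
  forall F1 F2, zariski_closed F1 -> zariski_closed F2 ->
    A `<=` F1 `|` F2 -> A `<=` F1 \/ A `<=` F2.

Definition zariski_constructible A : Prop :=
  exists (r : nat) (U F : 'I_r -> set 'rV[k]_N),
    (forall i, zariski_open (U i) /\ zariski_closed (F i)) /\
    A = \bigcup_i (U i `&` F i).

End Zariski.

Section AffineSpace.
Variables (n d : nat) (k : fieldType).

Definition dp_dim : nat := #|{: 'X_{1..n < d.+1}}|.

(* The element of P_{<= d} with coordinates v in the basis of the divided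
   monomials of degree at most d. *)
Definition dp_of_coords (v : 'rV[k]_dp_dim) : dpoly n k :=
  \sum_(i < dp_dim) v ord0 i *: 'X_[bmnm (enum_val i)].

Definition in_coords (G : set (dpoly n k)) : set 'rV[k]_dp_dim :=
  [set v | G (dp_of_coords v)].

End AffineSpace.
Arguments in_coords {n} d {k} G.

Definition char_zero_or_gt (k : fieldType) (d : nat) : Prop :=
  forall p : nat, p \in [pchar k] -> (d < p)%N.

(* Main.v *)
Require Import Defs.
From HB Require Import structures.
From mathcomp Require Import all_boot all_order all_algebra.
From mathcomp Require Import boolp classical_sets.
From mathcomp Require Import mpoly.
From mathcomp Require Import closed_field algC.

Set Implicit Arguments.
Unset Strict Implicit.
Unset Printing Implicit Defensive.

Import GRing.Theory.

Local Open Scope ring_scope.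
Local Open Scope quotient_scope.

(* Let [pair f p] be the constant term of [p] contracted with [f]. An algebra
   [Apolar f] with [deg f = d] is canonically graded iff there are a nonzero form
   [F] of degree [d], a unit [u = 1 + ...] and a substitution
   [s_i = alpha_i + (order >= 2)] with
     pair f p = pair F (u * p(s))   for all p.
   If [Apolar f ~ gr (Apolar f)], the isomorphism can be corrected to be the
   identity on the tangent space; it then presents [Apolar f] by generators
   [t_i = alpha_i + ...] with homogeneous relations. Since the socle is a line, the
   functional [pair f] read in these generators is a unit multiple of its
   degree-[d] part [F], and [s] is the substitution inverse to [t]. Conversely,
   [p |-> p(s)] identifies [Apolar f] with the graded algebra [Apolar F].
   Hence the set is the image of a nonempty open subset of an affine space under
   a polynomial map, which is irreducible because affine space is, and
   constructible by quantifier elimination. It does not contain [0] but is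
   stable under nonzero scalars, so it is not closed; and [x^[3] + c y^[2]]
   lies in it only for [c = 0], so for [n = 2], [d = 3] it is not open. *)

(** * Truncated substitutions *)

Section Evaluation.
Variables (n : nat) (k : comNzRingType) (A : comAlgType k).
Implicit Types (z : 'I_n -> A) (p q : {mpoly k[n]}).

Definition ev z : {mpoly k[n]} -> A := mmap (in_alg A) z.

Lemma ev_is_zmod_morphism z : zmod_morphism (ev z).
Proof. by move=> p q; exact: mmapB. Qed.
Lemma ev_is_monoid_morphism z : monoid_morphism (ev z).
Proof.
by have [mM m1] := @mmap_is_multiplicative n k A z (in_alg A); split.
Qed.
Lemma ev_is_scalable z : scalable (ev z).
Proof. by move=> c p; rewrite /ev mmapZ mulr_algl. Qed.

HB.instance Definition _ z :=
  GRing.isZmodMorphism.Build {mpoly k[n]} A (ev z) (ev_is_zmod_morphism z).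
HB.instance Definition _ z :=
  GRing.isMonoidMorphism.Build {mpoly k[n]} A (ev z) (ev_is_monoid_morphism z).
HB.instance Definition _ z :=
  GRing.isScalable.Build k {mpoly k[n]} A *:%R (ev z) (ev_is_scalable z).

Lemma evXU z i : ev z 'X_i = z i.
Proof. by rewrite /ev mmapX mmap1U. Qed.

Lemma evX z m : ev z 'X_[m] = \prod_i z i ^+ m i.
Proof. by rewrite /ev mmapX. Qed.

Lemma evE z p : ev z p = \sum_(m <- msupp p) p@_m *: \prod_i z i ^+ m i.
Proof.
rewrite [in LHS](mpolyE p) raddf_sum; apply: eq_bigr => m _.
by rewrite /= linearZ /= evX.
Qed.

Lemma eq_ev z z' : z =1 z' -> ev z =1 ev z'.
Proof. by move=> zz' p; rewrite (funext zz'). Qed.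

Lemma lrmorphism_ev (f : {lrmorphism {mpoly k[n]} -> A}) p :
  f p = ev (fun i => f 'X_i) p.
Proof.
rewrite evE [in LHS](mpolyE p) raddf_sum; apply: eq_bigr => m _.
rewrite /= linearZ /= mpolyXE_id rmorph_prod; congr (_ *: _).
by apply: eq_bigr => i _; rewrite rmorphXn.
Qed.

End Evaluation.

Lemma rmorph_ev n (k : comNzRingType) (A B : comAlgType k) (f : {lrmorphism A -> B})
    (z : 'I_n -> A) p : f (ev z p) = ev (fun i => f (z i)) p.
Proof.
rewrite -[LHS]/((f \o ev z) p) lrmorphism_ev.
by apply: eq_ev => i /=; rewrite evXU.
Qed.

Lemma ev_id n (k : comNzRingType) (p : {mpoly k[n]}) : ev (fun i => 'X_i) p = p.
Proof. exact: esym (lrmorphism_ev idfun p). Qed.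

(** * Order filtration and substitutions tangent to the identity *)

Section Order.
Variables (n : nat) (k : comNzRingType).
Implicit Types (p q : {mpoly k[n]}) (t : 'I_n -> {mpoly k[n]}).

Lemma mnm_gt0 (m : 'X_{1..n}) : m != 0%MM -> exists l, (U_(l) <= m)%MM.
Proof.
apply: contra_neqP => H; apply/mnmP => l; rewrite mnm0E; apply/eqP.
by apply: contra_notT H => ml; exists l; rewrite lep1mP.
Qed.

Definition ord_ge j p := forall m, (mdeg m < j)%N -> p@_m = 0.

Lemma ord_ge0 j : ord_ge j 0.
Proof. by move=> m _; rewrite mcoeff0. Qed.
Lemma ord_geD j p q : ord_ge j p -> ord_ge j q -> ord_ge j (p + q).
Proof. by move=> op oq m mj; rewrite mcoeffD op // oq // addr0. Qed.
Lemma ord_geN j p : ord_ge j p -> ord_ge j (- p).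
Proof. by move=> op m mj; rewrite mcoeffN op // oppr0. Qed.
Lemma ord_geZ j c p : ord_ge j p -> ord_ge j (c *: p).
Proof. by move=> op m mj; rewrite mcoeffZ op // mulr0. Qed.
Lemma ord_ge_sum j (I : Type) (r : seq I) (P : pred I) F :
  (forall i, P i -> ord_ge j (F i)) -> ord_ge j (\sum_(i <- r | P i) F i).
Proof.
by move=> H; elim/big_ind: _ => //; [exact: ord_ge0 | move=> x y; exact: ord_geD].
Qed.
Lemma ord_geW i j p : (i <= j)%N -> ord_ge j p -> ord_ge i p.
Proof. by move=> ij op m mi; apply: op; exact: leq_trans ij. Qed.
Lemma ord_ge_any p : ord_ge 0 p.
Proof. by []. Qed.
Lemma ord_geX m : ord_ge (mdeg m) 'X_[m].
Proof. by move=> m' /=; rewrite mcoeffX; case: eqP => // ->; rewrite ltnn. Qed.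

Lemma ord_geM i j p q : ord_ge i p -> ord_ge j q -> ord_ge (i + j) (p * q).
Proof.
move=> op oq m mij; rewrite mcoeffM big1 // => -[a b] /= /eqP mE.
have [ai|ia] := ltnP (mdeg a) i; first by rewrite op ?mul0r.
rewrite oq ?mulr0 //; rewrite mE mdegD in mij.
by rewrite -(ltn_add2l i); apply: leq_ltn_trans mij; rewrite leq_add2r.
Qed.

Lemma ord_geMr j p q : ord_ge j p -> ord_ge j (p * q).
Proof. by move=> op; rewrite -(addn0 j); apply: ord_geM. Qed.
Lemma ord_geMl j p q : ord_ge j q -> ord_ge j (p * q).
Proof. by rewrite mulrC; exact: ord_geMr. Qed.

Lemma const_partP p : ord_ge 1 p <-> p@_0%MM = 0.
Proof.
split=> [|p0 m]; first by apply; rewrite mdeg0.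
by rewrite ltnS leqn0 mdeg_eq0 => /eqP ->.
Qed.

Lemma ord_ge_const p : ord_ge 1 (p - p@_0%MM *: 1).
Proof. by apply/const_partP; rewrite mcoeffB mcoeffZ mcoeff1 eqxx mulr1 subrr. Qed.

(** These represent the coordinate changes of the power series ring that are the identity on the
    tangent space. Polynomials suffice, as terms of degree above [d] are invisible to a dual
    generator of degree [d]. *)
Definition tangent_id t := forall i, ord_ge 2 (t i - 'X_i).

(** So [p] and [q] have the same part of degree [j] and nothing below it. The relation is
    multiplicative, which reduces a monomial to its factors. *)
Let lead j p q := ord_ge j q /\ ord_ge j.+1 (p - q).

Let leadM i j p q p' q' : lead i p q -> lead j p' q' -> lead (i + j) (p * p') (q * q').
Proof.
move=> [oq opq] [oq' opq']; split; first exact: ord_geM.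
have -> : p * p' - q * q' = p * (p' - q') + (p - q) * q'.
  by rewrite mulrBr mulrBl addrA subrK.
have op : ord_ge i p.
  by rewrite -(subrK q p); apply: ord_geD => //; apply: ord_geW opq.
by apply: ord_geD; [rewrite -addnS | rewrite -addSn]; apply: ord_geM.
Qed.

Lemma subst_monomial t m : tangent_id t -> ord_ge (mdeg m).+1 (ev t 'X_[m] - 'X_[m]).
Proof.
move=> tt; rewrite evX mpolyXE_id mdegE.
suff [] : lead (\sum_i m i) (\prod_i t i ^+ m i) (\prod_i 'X_i ^+ m i) by [].
have lead1 : lead 0 1 1 by split; rewrite ?subrr //; exact: ord_ge0.
apply: (big_rec3 (fun s x y => lead s x y)) => // i s x y _ Hsxy; apply: leadM => //.
elim: (m i) => [|j IH]; first exact: lead1.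
rewrite !exprS -add1n; apply: leadM => //; split; last exact: tt.
by rewrite -(mdeg1 i); apply: ord_geX.
Qed.

Lemma subst_ord t j p : tangent_id t -> ord_ge j p -> ord_ge j.+1 (ev t p - p).
Proof.
move=> tt op; rewrite [p in ev t p](mpolyE p) [X in _ - X](mpolyE p) raddf_sum -sumrB.
rewrite big_seq; apply: ord_ge_sum => m mp; rewrite /= linearZ -scalerBr.
apply: ord_geZ; apply: ord_geW (subst_monomial (m := m) tt); rewrite ltnS leqNgt.
by apply/negP => /op; apply/eqP; rewrite -mcoeff_msupp.
Qed.

Lemma subst_ord_ge t j p : tangent_id t -> ord_ge j p -> ord_ge j (ev t p).
Proof.
move=> tt op; rewrite -(subrK p (ev t p)); apply: ord_geD => //.
by apply: ord_geW (subst_ord tt op).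
Qed.

(* Nakayama, modulo the power [d.+1] of the maximal ideal. *)
Lemma subst_onto d t j p : tangent_id t -> ord_ge j p ->
  exists2 q, ord_ge j.+1 q & ord_ge d.+1 (p - ev t (p + q)).
Proof.
move=> tt; have [] := leqP d.+1 j => [dj op|].
  exists 0; [exact: ord_ge0 | rewrite addr0 -opprB; apply: ord_geN].
  exact: ord_geW (leqW dj) (subst_ord tt op).
rewrite ltnS => jd; rewrite -(subKn jd).
elim: (d - j)%N p => [|i IH] p op.
  exists 0; [exact: ord_ge0 | rewrite addr0 -opprB; apply: ord_geN].
  by apply: subst_ord => //; rewrite subn0 in op.
(* The defect [p - ev t p] has order one higher than [p], so the induction corrects it. *)
have opt := ord_geN (subst_ord tt op); rewrite opprB in opt.
have opt' : ord_ge (d - i) (p - ev t p).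
  by apply: ord_geW opt; rewrite subnS; case: (d - i)%N.
have [q oq oq'] := IH _ opt'; exists (p - ev t p + q).
  by apply: ord_geD => //; apply: ord_geW oq; rewrite subnS; case: (d - i)%N.
by rewrite raddfD opprD addrA.
Qed.

Lemma subst_left_inverse d t : tangent_id t ->
  exists2 t', tangent_id t' & forall i, ord_ge d.+1 (ev t (t' i) - 'X_i).
Proof.
move=> tt.
have /fin_all_exists2[q oq qE] i :
    exists2 q, ord_ge 2 q & ord_ge d.+1 ('X_i - ev t ('X_i + q)).
  by apply: subst_onto => //; rewrite -(mdeg1 i); apply: ord_geX.
exists (fun i => 'X_i + q i) => i; first by rewrite addrC addKr.
by rewrite -opprB; apply: ord_geN.
Qed.

Lemma subst_congr d t t' p : (forall i, ord_ge d (t i - t' i)) ->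
  ord_ge d (ev t p - ev t' p).
Proof.
move=> tt'; rewrite !evE -sumrB; apply: ord_ge_sum => m _.
rewrite -scalerBr; apply: ord_geZ.
apply: (big_rec2 (fun x y => ord_ge d (x - y))) => [|i x y _ oxy].
  by rewrite subrr; exact: ord_ge0.
suff ot : ord_ge d (t i ^+ m i - t' i ^+ m i).
  have -> (a b : {mpoly k[n]}) : a * x - b * y = a * (x - y) + (a - b) * y.
    by rewrite mulrBr mulrBl addrA subrK.
  by apply: ord_geD; [apply: ord_geMl | apply: ord_geMr].
by rewrite subrXX; apply: ord_geMr.
Qed.

(** Inverting on one side twice gives [t'] from [t] and [t''] from [t']. As in a group, [t] and
    [t''] then agree up to order [d.+1], so [t'] inverts [t] on both sides. *)
Lemma subst_inverse d t : tangent_id t ->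
  exists t', [/\ tangent_id t', forall p, ord_ge d.+1 (ev t (ev t' p) - p) &
    forall p, ord_ge d.+1 (ev t' (ev t p) - p)].
Proof.
have inv s s' : (forall i, ord_ge d.+1 (ev s (s' i) - 'X_i)) ->
    forall p, ord_ge d.+1 (ev s (ev s' p) - p).
  move=> ss' p; rewrite -[X in _ - X]ev_id rmorph_ev.
  exact: subst_congr.
move=> tt; have [t' tt' /inv tE] := subst_left_inverse d tt.
have [t'' tt'' /inv t'E] := subst_left_inverse d tt'.
exists t'; split; [exact: tt' | exact: tE | move=> p].
have E q : ord_ge d.+1 (ev t q - ev t'' q).
  have -> : ev t q - ev t'' q =
     ev t (q - ev t' (ev t'' q)) + (ev t (ev t' (ev t'' q)) - ev t'' q).
    by rewrite raddfB addrA subrK.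
  apply: ord_geD => //; apply: subst_ord_ge => //.
  by rewrite -opprB; apply: ord_geN.
have -> : ev t' (ev t p) - p = ev t' (ev t p - ev t'' p) + (ev t' (ev t'' p) - p).
  by rewrite raddfB addrA subrK.
by apply: ord_geD => //; apply: subst_ord_ge.
Qed.

End Order.

(** * The pairing and its unit-substitution orbits *)

Section Pairing.
Variables (n : nat) (k : comNzRingType).
Implicit Types (f p q : {mpoly k[n]}).

Local Notation hpart := (pihomog mdeg).

Lemma mcoeff_pihomog i p m : (hpart i p)@_m = if mdeg m == i then p@_m else 0.
Proof.
have [pD mD] := (leq_maxl (msize p) (mdeg m).+1, leq_maxr (msize p) (mdeg m).+1).
move: (maxn _ _) pD mD => D pD mD; rewrite (pihomogwE _ _ pD) raddf_sum /=.
case: eqP => [mi|/eqP mi]; last first.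
  rewrite big1 // => a /eqP ai; rewrite mcoeffZ mcoeffX.
  case: eqP => [am|]; last by rewrite mulr0.
  by rewrite -am ai eqxx in mi.
rewrite (bigD1 (BMultinom mD)) /=; last by rewrite mi.
rewrite mcoeffZ mcoeffX eqxx mulr1 big1 ?addr0 // => a /andP[_ am].
rewrite mcoeffZ mcoeffX; case: eqP => [ame|]; last by rewrite mulr0.
by case/eqP: am; apply: val_inj.
Qed.

Lemma ord_ge_pihomog i p : ord_ge i (hpart i p).
Proof. by move=> m mi; rewrite mcoeff_pihomog ltn_eqF. Qed.

Definition pair f p := \sum_(b <- msupp f) f@_b * p@_b.

Lemma pairD f p q : pair f (p + q) = pair f p + pair f q.
Proof. by rewrite -big_split; apply: eq_bigr => b _; rewrite mcoeffD mulrDr. Qed.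
Lemma pairZ f c p : pair f (c *: p) = c * pair f p.
Proof. by rewrite mulr_sumr; apply: eq_bigr => b _; rewrite mcoeffZ mulrCA. Qed.
Lemma pair0 f : pair f 0 = 0.
Proof. by rewrite -(scale0r (0 : {mpoly k[n]})) pairZ mul0r. Qed.
Lemma pairB f p q : pair f (p - q) = pair f p - pair f q.
Proof. by rewrite pairD -scaleN1r pairZ mulN1r. Qed.
Lemma pair_sum f (I : Type) (r : seq I) (P : pred I) F :
  pair f (\sum_(i <- r | P i) F i) = \sum_(i <- r | P i) pair f (F i).
Proof.
by apply: (big_morph (pair f)) => [p q|]; rewrite ?pair0 ?pairD.
Qed.

Lemma pairwE D f p : (msize f <= D)%N ->
  pair f p = \sum_(b : 'X_{1..n < D}) f@_b * p@_b.
Proof.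
move=> fD; rewrite /pair (ssrcomplements.big_mksub 'X_{1..n < D}) ?msupp_uniq //=; last first.
  by move=> m /msize_mdeg_lt /leq_trans; apply.
rewrite big_rmcond //= => m /memN_msupp_eq0 ->; exact: mul0r.
Qed.

Lemma pairX f m : pair f 'X_[m] = f@_m.
Proof.
rewrite (@pairwE (maxn (msize f) (mdeg m).+1)) ?leq_maxl //.
rewrite (bigD1 (BMultinom (leq_maxr (msize f) (mdeg m).+1))) //=.
rewrite mcoeffX eqxx mulr1 big1 ?addr0 // => a am; rewrite mcoeffX.
case: eqP => [ame|]; last by rewrite mulr0.
by case/eqP: am; apply: val_inj.
Qed.

Lemma pair_pihomog i f p : pair (hpart i f) p = pair f (hpart i p).
Proof.
rewrite !(@pairwE (maxn (msize f) (msize (hpart i f)))) ?leq_maxl ?leq_maxr //.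
apply: eq_bigr => b _; rewrite !mcoeff_pihomog.
by case: ifP => _; rewrite ?mul0r ?mulr0.
Qed.

Lemma pair_ord d f p : (msize f <= d)%N -> ord_ge d p -> pair f p = 0.
Proof. by move=> fd op; rewrite (pairwE _ fd) big1 // => b _; rewrite op ?mulr0 ?bmdeg. Qed.

Lemma pair_congr d f p q : (msize f <= d)%N -> ord_ge d (p - q) -> pair f p = pair f q.
Proof. by move=> fd opq; apply/subr0_eq; rewrite -pairB (pair_ord fd). Qed.

Lemma linear_ext (g h : {mpoly k[n]} -> k) :
  (forall c p q, g (c *: p + q) = c * g p + g q) ->
  (forall c p q, h (c *: p + q) = c * h p + h q) ->
  (forall m, g 'X_[m] = h 'X_[m]) -> g =1 h.
Proof.
move=> gl hl gh p; rewrite (mpolyE p).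
have l0 (g' : {mpoly k[n]} -> k) :
    (forall c p q, g' (c *: p + q) = c * g' p + g' q) -> g' 0 = 0.
  by move=> /(_ (-1) 0 0); rewrite scaler0 addr0 mulN1r addNr.
elim: (msupp p) => [|m r IH]; first by rewrite !big_nil !l0.
by rewrite !big_cons gl hl gh IH.
Qed.

Lemma pair_eq0_mul f p :
  (forall m, pair f (p * 'X_[m]) = 0) -> forall q, pair f (p * q) = 0.
Proof.
move=> H; apply: (linear_ext (h := fun=> 0)) => // [c q r|c q r].
  by rewrite mulrDr -scalerAr pairD pairZ.
by rewrite mulr0 addr0.
Qed.

(** Only the degree-[d] part of a product pairs with a form of degree [d], so a projection of one
    factor can be traded for the complementary projection of the other. *)
Lemma pair_homogM d f i p q : f \is d.-homog -> (i <= d)%N ->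
  pair f (hpart i p * q) = pair f (p * hpart (d - i) q).
Proof.
move=> /dhomogP fd id; rewrite /pair big_seq [RHS]big_seq; apply: eq_bigr => b /fd bd.
rewrite !mcoeffM; congr (_ * _); apply: eq_bigr => -[a c] /= /eqP bE.
rewrite !mcoeff_pihomog; have : (mdeg a + mdeg c = d)%N by rewrite -mdegD -bE.
move=> acd; have -> : (mdeg c == (d - i)%N) = (mdeg a == i).
  apply/eqP/eqP => [cE|aE]; last by rewrite -acd aE addKn.
  by apply/eqP; rewrite -(eqn_add2r (mdeg c)) acd cE subnKC.
by case: ifP => _; rewrite ?mul0r ?mulr0.
Qed.

(** The annihilator of a form is a homogeneous ideal: once the projection sits on the other factor,
    the hypothesis applies. *)
Lemma pair_pihomog_eq0 d f i p : f \is d.-homog -> (msize f <= d.+1)%N ->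
  (forall q, pair f (p * q) = 0) -> forall q, pair f (hpart i p * q) = 0.
Proof.
move=> fd fs H q; have [id|di] := leqP i d; first by rewrite (pair_homogM _ _ fd).
by apply: (pair_ord fs); apply: ord_geMr; apply: ord_geW (@ord_ge_pihomog i p).
Qed.

(** The unit is cancelled without being inverted, by induction on decreasing order of [q]: [p * q]
    is [u * (p * q)] plus [p * ((1 - u) * q)], and [(1 - u) * q] has order one higher. *)
Lemma pair_unit_eq0 d f u p : (msize f <= d.+1)%N -> u@_0%MM = 1 ->
  (forall q, pair f (u * (p * q)) = 0) -> forall q, pair f (p * q) = 0.
Proof.
move=> fs u1 H q.
suff K j : (j <= d.+1)%N -> forall q, ord_ge (d.+1 - j) q -> pair f (p * q) = 0.
  by apply: (K d.+1) => //; rewrite subnn.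
elim: j => [|j IH] jd {}q oq.
  by apply: (pair_ord fs); apply: ord_geMl; rewrite subn0 in oq.
have -> : p * q = u * (p * q) + p * ((1 - u) * q).
  by rewrite (mulrCA u) -mulrDr mulrBl mul1r addrC subrK.
rewrite pairD H add0r; apply: IH; first exact: ltnW.
rewrite -subSS subSn // -add1n; apply: ord_geM => //.
by apply/const_partP; rewrite mcoeffB mcoeff1 eqxx u1 subrr.
Qed.

End Pairing.

(** * Orbits of forms and homogeneous relations *)

Section Orbit.
Variables (n : nat) (k : fieldType).
Implicit Types (f F u p q : {mpoly k[n]}) (s t : 'I_n -> {mpoly k[n]}).

Local Notation hpart := (pihomog mdeg).

(* [ev t p] annihilates [f]; equivalently [p] lies in the kernel of
   [p |-> p(t) : k[X] -> Apolar f]. *)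
Definition subst_ann f t p := forall q, pair f (ev t p * q) = 0.

(** Homogeneity of the ideal of relations among the generators [t i] of Apolar f. It mediates
    between canonical gradedness and [orbit_of]. *)
Definition graded_by f t :=
  tangent_id t /\ forall p i, subst_ann f t p -> subst_ann f t (hpart i p).

Definition orbit_of d f F u s := [/\ F \is d.-homog, u@_0%MM = 1, tangent_id s &
  forall p, pair f p = pair F (u * ev s p)].

Lemma dhomog_msize_le d F : F \is d.-homog -> (msize F <= d.+1)%N.
Proof.
have [->|F0] := eqVneq F 0; first by rewrite msize0.
by move=> /dhomogP Fd; rewrite -(mlead_deg F0) Fd ?mlead_supp.
Qed.

(** For [t] inverse to [s] up to order [d.+1], the relations among the [t i] are exactly the
    annihilator of the form [F], because the unit can be cancelled; that annihilator is
    homogeneous. *)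
Lemma orbit_graded d f F u s : orbit_of d f F u s -> exists t, graded_by f t.
Proof.
case=> Fd u1 ss fE; have Fs := dhomog_msize_le Fd.
have [t [tt st ts]] := subst_inverse d ss; exists t.
split; first exact: tt.
move=> p i.
have annE p' : subst_ann f t p' <-> forall q, pair F (p' * q) = 0.
  have stE q : pair F (u * (ev s (ev t p') * ev s (ev t q))) = pair F (u * (p' * q)).
    apply: (pair_congr Fs); rewrite -mulrBr; apply: ord_geMl.
    by rewrite -!rmorphM; exact: st.
  split=> [pf|pF] q.
    apply: (pair_unit_eq0 Fs u1) => {}q.
    by rewrite -stE -rmorphM -fE.
  rewrite fE rmorphM /= -(pF (u * ev s q)); apply: (pair_congr Fs).
  have -> : u * (ev s (ev t p') * ev s q) - p' * (u * ev s q)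
      = (ev s (ev t p') - p') * (u * ev s q) by rewrite mulrBl mulrCA.
  exact: ord_geMr (st p').
by rewrite !annE => pF; exact: pair_pihomog_eq0 Fd Fs pF.
Qed.

Lemma msize_top d f : msize f = d.+1 -> exists2 m, mdeg m = d & f@_m != 0.
Proof.
move=> fd; have f0 : f != 0 by rewrite -msize_poly_eq0 fd.
exists (mlead f); last by rewrite mleadc_eq0.
by apply/eqP; rewrite -eqSS mlead_deg // fd.
Qed.

Section Solve.
Variables (d : nat) (F : {mpoly k[n]}) (g : {mpoly k[n]} -> k).
Hypothesis (Fs : (msize F <= d.+1)%N).
Hypothesis (gl : forall c p q, g (c *: p + q) = c * g p + g q).
Hypothesis (g_ord : forall p, ord_ge d.+1 p -> g p = 0).
Hypothesis (g_ann : forall p, (forall q, pair F (p * q) = 0) -> g p = 0).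

(* The functionals [p |-> pair F (u * p)] form a space which is its own
   double orthogonal. *)
Lemma solve_unit : exists u, forall p, g p = pair F (u * p).
Proof.
pose I := 'X_{1..n < d.+1}; pose e (i : 'I_#|{: I}|) : 'X_{1..n} := bmnm (enum_val i).
have g0 : g 0 = 0 by apply: g_ord; exact: ord_ge0.
(* The catalecticant matrix of [F]. The combination of its rows with weights [w] is the functional
   [pair F (u * _)] for the polynomial [u] with coefficients [w], so [g] must be shown to lie in the
   row space. *)
pose M : 'M[k]_#|{: I}| := \matrix_(i, j) F@_(e i + e j).
pose v : 'rV[k]_#|{: I}| := \row_j g 'X_[e j].
pose comb (c : 'I_#|{: I}| -> k) := \sum_i c i *: 'X_[e i] : {mpoly k[n]}.
have combE c m : pair F (comb c * 'X_[m]) = \sum_i c i * F@_(e i + m).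
  rewrite mulr_suml pair_sum; apply: eq_bigr => i _.
  by rewrite -scalerAl pairZ -mpolyXD pairX.
have e_onto m : (mdeg m < d.+1)%N -> exists i, m = e i.
  by move=> md; exists (enum_rank (BMultinom md)); rewrite /e enum_rankK.
have /submxP[w vE] : (v <= M)%MS.
  rewrite submxE; apply/eqP/matrixP => i0 j; rewrite ord1 mxE [RHS]mxE {i0}.
  (* Since [M] is symmetric, a column of its cokernel is the coefficient vector of a polynomial
     annihilating [F], and [g] kills such polynomials. *)
  pose c i := cokermx M i j.
  have cM i : \sum_l c l * F@_(e l + e i) = 0.
    have /matrixP/(_ i j) := mulmx_coker M; rewrite mxE [RHS]mxE => MC; rewrite -[RHS]MC.
    by apply: eq_bigr => l _; rewrite mxE mulrC addmC.
  transitivity (g (comb c)).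
    rewrite /comb; apply: esym.
    elim/big_rec2: _ => // i y1 y2 _ <-.
    by rewrite gl mxE mulrC.
  apply: g_ann; apply: pair_eq0_mul => m; have [md|dm] := ltnP (mdeg m) d.+1.
    by have [i ->] := e_onto m md; rewrite combE cM.
  by apply: (pair_ord Fs); apply: ord_geMl; apply: ord_geW dm (@ord_geX _ _ m).
exists (comb (w ord0)); apply: linear_ext => // [c p q|m].
  by rewrite mulrDr -scalerAr pairD pairZ.
have [md|dm] := ltnP (mdeg m) d.+1; last first.
  have om := ord_geW dm (@ord_geX n k m).
  by rewrite g_ord // (pair_ord Fs) //; apply: ord_geMl.
have [i ->] := e_onto m md.
rewrite combE; have /matrixP/(_ ord0 i) := vE; rewrite !mxE => ->.
by apply: eq_bigr => j _; rewrite mxE.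
Qed.

End Solve.

(** The functional [nu] is [pair f] read in the generators [t], and [F] is the top form of [f]. The
    point is that the annihilator of [F] consists of relations among the [t i], so [nu] vanishes on
    it and [solve_unit] expresses [nu] through [F]; substituting the inverse [s] of [t] then
    recovers [pair f]. *)
Lemma graded_orbit d f t : msize f = d.+1 -> graded_by f t ->
  exists F u s, orbit_of d f F u s.
Proof.
move=> fd [tt Kh].
have fs : (msize f <= d.+1)%N by rewrite fd.
have [s [ss ts st]] := subst_inverse d tt.
pose nu p := pair f (ev t p).
have nul c p q : nu (c *: p + q) = c * nu p + nu q.
  by rewrite /nu raddfD /= linearZ /= pairD pairZ.
have nu_ord p : ord_ge d.+1 p -> nu p = 0.
  by move=> op; apply: (pair_ord fs); apply: subst_ord_ge.
have KP p : subst_ann f t p <-> forall q, nu (p * q) = 0.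
  split=> H q; first by rewrite /nu rmorphM /=; exact: H.
  rewrite -(H (ev s q)) /nu rmorphM /=; apply: (pair_congr fs).
  by rewrite -mulrBr; apply: ord_geMl; rewrite -opprB; apply: ord_geN.
have KD p q : subst_ann f t p -> subst_ann f t q -> subst_ann f t (p + q).
  by move=> Kp Kq r; rewrite raddfD /= mulrDl pairD Kp Kq addr0.
have KZ c p : subst_ann f t p -> subst_ann f t (c *: p).
  by move=> Kp r; rewrite linearZ -scalerAl pairZ Kp mulr0.
have KM p q : subst_ann f t p -> subst_ann f t (p * q).
  by move=> /KP Kp; apply/KP => r; rewrite -mulrA.
have K0 : subst_ann f t 0 by move=> q; rewrite raddf0 mul0r pair0.
have K_ord p : ord_ge d.+1 p -> subst_ann f t p.
  by move=> op; apply/KP => q; apply: nu_ord; apply: ord_geMr.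
pose F := hpart d f.
have Fd : F \is d.-homog by exact: pihomogP.
have Fs := dhomog_msize_le Fd.
(* In order at least [d] the substitution only alters terms of degree above [d], and only the
   degree-[d] part of [f] is met. *)
have nuF p : ord_ge d p -> nu p = pair F p.
  move=> op; rewrite /F pair_pihomog /nu; apply: (pair_congr fs).
  rewrite -(subrK p (ev t p)) -addrA; apply: ord_geD; first exact: subst_ord.
  move=> m; rewrite ltnS leq_eqVlt mcoeffB mcoeff_pihomog => /orP[/eqP->|md].
    by rewrite eqxx subrr.
  by rewrite (ltn_eqF md) op // subr0.
have [m0 m0d fm0] := msize_top fd.
have nu_m0 : nu 'X_[m0] != 0.
  rewrite nuF; first by rewrite pairX mcoeff_pihomog m0d eqxx.
  by rewrite -m0d; apply: ord_geX.
have dhomog_ord j p : p \is j.-homog -> ord_ge j p.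
  by move=> pj m mj; rewrite (dhomog_nemf_coeff pj) // ltn_eqF.
(* The socle of Apolar f is a line. *)
have socle p : (forall l, subst_ann f t (p * 'X_l)) -> nu p = 0 -> subst_ann f t p.
  move=> KX nup; apply/KP.
  apply: (linear_ext (h := fun=> 0)) => [c q r|c q r|m].
  - by rewrite mulrDr -scalerAr nul.
  - by rewrite mulr0 addr0.
  have [->|] := eqVneq m 0%MM; first by rewrite mpolyX0 mulr1.
  move=> /mnm_gt0[l lm]; rewrite -(submK lm) addmC mpolyXD mulrA; apply: (KP _).1; exact: KX.
(* Descending induction on the degree [j]: if [p] annihilates [F], so do the products [p * 'X_l],
   which are relations by induction. Hence [p] maps into the socle. *)
have hom_ann i : forall j p, (d.+1 <= i + j)%N -> p \is j.-homog ->
    (forall q, pair F (p * q) = 0) -> subst_ann f t p.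
  elim: i => [|i IH] j p dij pj pF.
    by apply: K_ord; apply: ord_geW dij (dhomog_ord _ _ pj).
  have KX l : subst_ann f t (p * 'X_l).
    apply: (IH j.+1); first by rewrite addnS -addSn.
      by rewrite -addn1; apply: dhomogM => //; rewrite dhomogX; apply/eqP; exact: mdeg1.
    by move=> q; rewrite -mulrA.
  have [dj|jd|jd] := ltngtP d j.
  - by apply: K_ord; apply: ord_geW dj (dhomog_ord _ _ pj).
  (* Below degree [d], subtract the multiple of ['X_[m0]] that makes [nu] vanish. The difference is
     a relation by [socle], and so is its degree-[j] part, which is [p] because ['X_[m0]] has degree
     [d]. *)
  - pose c := nu p / nu 'X_[m0].
    have Kc : subst_ann f t (p - c *: 'X_[m0]).
      apply: socle => [l|].
        rewrite mulrBl; apply: KD; first exact: KX.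
        rewrite -scalerAl -scalerN -mulN1r; apply: KZ; apply: K_ord.
        rewrite -mpolyXD; apply: ord_geMl.
        apply: ord_geW (@ord_geX _ _ (m0 + U_(l))%MM).
        by rewrite mdegD mdeg1 m0d addn1.
      by rewrite -scaleNr addrC nul mulNr divfK // addNr.
    have X0 : hpart j 'X_[m0] = 0 :> {mpoly k[n]}.
      apply/mpolyP => a; rewrite mcoeff_pihomog mcoeffX mcoeff0.
      case: eqP => // aj; case: eqP => // am; by move: jd; rewrite -aj -am m0d ltnn.
    have := Kh _ j Kc.
    rewrite pihomogB (pihomog_dE pj) linearZ /= X0 scaler0 subr0; exact.
  - apply: socle; first exact: KX.
    have := pF 1; rewrite mulr1 => <-; apply: nuF; rewrite jd; exact: dhomog_ord.
have F_ann p : (forall q, pair F (p * q) = 0) -> nu p = 0.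
  move=> pF; suff /KP/(_ 1) : subst_ann f t p by rewrite mulr1.
  rewrite (pihomog_partitionE (leqnn (mmeasure mdeg p))).
  elim/big_ind: _; [exact: K0 | exact: KD | move=> i _].
  apply: (hom_ann d.+1 i); [exact: leq_addr | exact: pihomogP |].
  exact: pair_pihomog_eq0 Fd Fs pF.
have [u nuE] := solve_unit Fs nul nu_ord F_ann.
exists F, u, s; split=> //; last first.
  move=> p; rewrite -nuE /nu; apply: (pair_congr fs).
  by rewrite -opprB; apply: ord_geN.
have om0 : ord_ge d ('X_[m0] : {mpoly k[n]}) by rewrite -m0d; apply: ord_geX.
(* The unit is normalized by testing on ['X_[m0]]: only the constant term of [u] contributes there,
   while [nu] and [pair F] take the same nonzero value. *)
apply: (mulIf nu_m0); rewrite mul1r [in LHS](nuF _ om0) -pairZ nuE.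
apply: (pair_congr Fs); rewrite -opprB; apply: ord_geN.
have -> : u * 'X_[m0] - u@_0%MM *: 'X_[m0] = (u - u@_0%MM *: 1) * 'X_[m0].
  by rewrite mulrBl -scalerAl mul1r.
rewrite -add1n; exact: ord_geM (ord_ge_const u) om0.
Qed.

End Orbit.

(** * Apolar algebras and associated graded algebras *)

Lemma lrmorphismP (k : comNzRingType) (A B : comAlgType k) (g : A -> B) :
  zmod_morphism g -> monoid_morphism g -> scalable g ->
  exists h : {lrmorphism A -> B}, h =1 g.
Proof.
move=> ga gm gs.
pose h : {lrmorphism A -> B} := HB.pack g (GRing.isZmodMorphism.Build _ _ g ga)
  (GRing.isMonoidMorphism.Build _ _ g gm) (GRing.isScalable.Build _ _ _ _ g gs).
by exists h.
Qed.

Section Quotients.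
Variables (k : comNzRingType).

Definition quot_map (R : comAlgType k) (I : idealr R) : R -> {ideal_quot I} :=
  \pi_{ideal_quot I}.

Lemma quot_map_zmod (R : comAlgType k) (I : idealr R) : zmod_morphism (quot_map I).
Proof. by move=> x y; rewrite /quot_map rmorphB. Qed.
Lemma quot_map_monoid (R : comAlgType k) (I : idealr R) : monoid_morphism (quot_map I).
Proof. by split=> [|x y]; rewrite /quot_map ?rmorph1 ?rmorphM. Qed.
Lemma quot_map_scalable (R : comAlgType k) (I : idealr R) : scalable (quot_map I).
Proof.
move=> c x; have [_ M] := quot_map_monoid I.
by rewrite -mulr_algl M.
Qed.

HB.instance Definition _ (R : comAlgType k) (I : idealr R) :=
  GRing.isZmodMorphism.Build R {ideal_quot I} (quot_map I) (quot_map_zmod I).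
HB.instance Definition _ (R : comAlgType k) (I : idealr R) :=
  GRing.isMonoidMorphism.Build R {ideal_quot I} (quot_map I) (quot_map_monoid I).
HB.instance Definition _ (R : comAlgType k) (I : idealr R) :=
  GRing.isScalable.Build k R {ideal_quot I} *:%R (quot_map I) (quot_map_scalable I).

Lemma quot_map_eq0 (R : comAlgType k) (I : idealr R) (x : R) :
  quot_map I x = 0 <-> x \in I.
Proof.
rewrite -[x in x \in _]subr0 Quotient.idealrBE; split=> [e|/eqP e].
  by apply/eqP; rewrite -[LHS]/(quot_map I x) e -[RHS]/(quot_map I 0) raddf0.
by rewrite -[LHS]/(\pi x) e; exact: raddf0 (quot_map I).
Qed.

Lemma quot_map_surj (R : comAlgType k) (I : idealr R) y : exists x, quot_map I x = y.
Proof. by exists (repr y); exact: reprK. Qed.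

Lemma lift_iso (R A B : comAlgType k) (a : {lrmorphism R -> A}) (b : {lrmorphism R -> B}) :
  (forall x, exists p, a p = x) -> (forall y, exists p, b p = y) ->
  (forall p, a p = 0 <-> b p = 0) ->
  exists2 h : {lrmorphism A -> B}, bijective h & forall p, h (a p) = b p.
Proof.
move=> asurj bsurj ab.
have [ra raE] := boolp.choice asurj; have [rb rbE] := boolp.choice bsurj.
have abE p q : a p = a q <-> b p = b q.
  by split=> e; apply/subr0_eq; rewrite -raddfB; apply/ab; rewrite raddfB /= e subrr.
pose g x := b (ra x).
have gE p : g (a p) = b p by apply/abE.
have [|||h hE] := lrmorphismP (g := g).
- by move=> x y; rewrite -(raE x) -(raE y) -raddfB !gE raddfB.
- split; first by rewrite -(rmorph1 a) gE rmorph1.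
  by move=> x y; rewrite -(raE x) -(raE y) -rmorphM !gE rmorphM.
- by move=> c x; rewrite -(raE x) -linearZ !gE linearZ.
exists h => [|p]; last by rewrite hE gE.
exists (fun y => a (rb y)) => [x|y].
  by rewrite hE -[RHS]raE; apply/abE; rewrite rbE.
by rewrite hE gE rbE.
Qed.

End Quotients.

(** * Apolar algebras as quotients of the polynomial ring *)

Section Presentation.
Variables (n : nat) (k : fieldType).
Implicit Types (f p q : {mpoly k[n]}).

Definition ps_of_mpoly p : pseries n k := PSeries (fun m => p@_m).

Lemma ps_of_mpoly_zmod : zmod_morphism ps_of_mpoly.
Proof. by move=> p q; apply: pseriesP => m; rewrite /= mcoeffB. Qed.
Lemma ps_of_mpoly_monoid : monoid_morphism ps_of_mpoly.
Proof.
split=> [|p q]; apply: pseriesP => m /=; first by rewrite mcoeff1.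
exact: mcoeffM.
Qed.
Lemma ps_of_mpoly_scalable : scalable ps_of_mpoly.
Proof. by move=> c p; apply: pseriesP => m; rewrite /= mcoeffZ. Qed.

(** The coefficient of x^[m] in the contraction is [pair f (p * 'X_[m])]. *)
Lemma contract_mpoly_eq0 f p :
  contract (ps_of_mpoly p) f = 0 <-> forall q, pair f (p * q) = 0.
Proof.
have E m : (contract (ps_of_mpoly p) f)@_m = pair f (p * 'X_[m]).
  rewrite (contract_coef _ _ (leq_maxl (msize f) (msize p))).
  move: (maxn _ _) (leq_maxr (msize f) (msize p)) => D pD.
  rewrite [in RHS](mpolywE pD) mulr_suml pair_sum; apply: eq_bigr => a _.
  by rewrite -scalerAl pairZ -mpolyXD pairX addmC.
split=> [H|H]; first by apply: pair_eq0_mul => m; rewrite -E H mcoeff0.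
by apply/mpolyP => m; rewrite E H mcoeff0.
Qed.

(** Polynomials already reach every class, since a series and its truncation to degree at most [d]
    act alike on [f]. *)
Lemma apolar_presentation d f (hf : f != 0) : msize f = d.+1 ->
  exists r : {lrmorphism {mpoly k[n]} -> apolar hf},
    (forall x, exists p, r p = x) /\
    (forall p, r p = 0 <-> forall q, pair f (p * q) = 0).
Proof.
move=> fd; have fs : (msize f <= d.+1)%N by rewrite fd.
have [|||r0 r0E] := lrmorphismP (g := ps_of_mpoly).
- exact: ps_of_mpoly_zmod.
- exact: ps_of_mpoly_monoid.
- exact: ps_of_mpoly_scalable.
exists (quot_map (ann_ideal hf) \o r0 : {lrmorphism _ -> apolar hf}); split=> [x|p].
  have [s <-] := quot_map_surj x; exists (ps_trunc d.+1 s).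
  apply/subr0_eq; rewrite /= r0E -raddfB; apply/quot_map_eq0/eqP/mpolyP => m.
  rewrite mcoeff0 (contract_coef _ _ fs) big1 // => a _.
  by rewrite /= ps_truncE ?bmdeg // subrr mul0r.
rewrite -contract_mpoly_eq0 /= r0E quot_map_eq0.
by split=> [/eqP|/eqP].
Qed.

End Presentation.

(** * Local algebras presented by polynomials, and their associated graded algebras *)

Section LocalAlgebra.
Variables (n d : nat) (k : fieldType) (A : comAlgType k).
Variable rho : {lrmorphism {mpoly k[n]} -> A}.
Hypothesis rho_surj : forall x, exists p, rho p = x.
Hypothesis rho_ord : forall p, ord_ge d.+1 p -> rho p = 0.
Implicit Types (p q : {mpoly k[n]}).

Local Notation hpart := (pihomog mdeg).
Local Notation m_ hA := [set x | x \in max_ideal hA]%classic.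

Lemma mcoeff0_exp p i : (p ^+ i)@_0%MM = p@_0%MM ^+ i.
Proof. exact: rmorphXn (mcoeff 0%MM) i p. Qed.

Lemma ord_ge_exp p i : ord_ge 1 p -> ord_ge i (p ^+ i).
Proof. by move=> op; elim: i => // i IH; rewrite exprS -add1n; apply: ord_geM. Qed.

Lemma nilpotent_nonunit (x : A) i : x ^+ i = 0 -> x \in nonunits A.
Proof.
move=> xi; apply/asboolP => -[y xy]; have := oner_neq0 A.
by rewrite -(expr1n A i) -xy exprMn xi mul0r eqxx.
Qed.

Lemma rho_nil p : ord_ge 1 p -> rho p ^+ d.+1 = 0.
Proof. by move=> op; rewrite -rmorphXn /= rho_ord //; apply: ord_ge_exp. Qed.

Lemma nonunits_rho p : rho p \in nonunits A <-> ord_ge 1 p.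
Proof.
split=> [pN|op]; last exact: nilpotent_nonunit (rho_nil op).
apply/const_partP/eqP; apply: contraPT pN => c0; move/asboolP; apply.
pose c := p@_0%MM; pose r := 1 - c^-1 *: p.
have or : ord_ge 1 r.
  by apply/const_partP; rewrite mcoeffB mcoeff1 eqxx mcoeffZ mulVf ?subrr.
(* The inverse of [1 - r] is a finite geometric series, because [r ^+ d.+1] maps to zero; the
   summands are shaped for [subrXX]. *)
pose S := \sum_(i < d.+1) 1 ^+ (d.+1.-1 - i) * r ^+ i.
exists (rho (c^-1 *: S)); rewrite -rmorphM -scalerAr scalerAl.
have -> : c^-1 *: p * S = 1 - r ^+ d.+1.
  by rewrite -[in RHS](expr1n _ d.+1) subrXX /r opprB addrC subrK.
by rewrite rmorphB rmorph1 /= (rho_ord (ord_ge_exp or)) subr0.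
Qed.

Lemma rho_local : local_ring A.
Proof.
move=> x y; have [[p <-] [q <-]] := (rho_surj x, rho_surj y).
by rewrite -rmorphD => /nonunits_rho op /nonunits_rho oq; apply/nonunits_rho/ord_geD.
Qed.

Variable hA : local_ring A.
Local Notation pow := (ideal_exp (m_ hA)).

Lemma max_rho p : rho p \in max_ideal hA <-> ord_ge 1 p.
Proof. exact: nonunits_rho. Qed.

Lemma ideal_exp1 x : pow 1 x <-> x \in max_ideal hA.
Proof.
split=> [[s [sI ->]]|xm].
  rewrite big_seq; apply: rpred_sum => xy /sI [xm _]; rewrite mulrC.
  exact: idealMr.
exists [:: (x, 1)]; rewrite big_seq1 mulr1; split=> // xy.
by rewrite inE => /eqP ->.
Qed.

(** The map [g] is arbitrary because, besides [rho], the lemma serves maps obtained from an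
    isomorphism with the associated graded algebra. *)
Lemma ideal_exp_ord (g : {lrmorphism {mpoly k[n]} -> A}) i p :
  (forall j, g 'X_j \in max_ideal hA) -> ord_ge i p -> pow i (g p).
Proof.
move=> gX op; rewrite [p]mpolyE raddf_sum big_seq; apply: ideal_exp_sum => m mp.
rewrite /= linearZ /= -mulr_algl; apply: ideal_expMl.
have {mp op} : (i <= mdeg m)%N.
  by rewrite leqNgt; apply/negP => /op; apply/eqP; rewrite -mcoeff_msupp.
elim: i m => // i IH m im.
have [l lm] : exists l, (U_(l) <= m)%MM.
  by apply: mnm_gt0; apply: contraTneq im => ->; rewrite mdeg0.
rewrite -(submK lm) addmC mpolyXD rmorphM -add1n.
apply: ideal_exp_mul; first by apply/ideal_exp1; exact: gX.
apply: IH; move: im; rewrite -{1}(submK lm) mdegD mdeg1 addn1; exact.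
Qed.

Lemma rho_max j : rho 'X_j \in max_ideal hA.
Proof. by apply/max_rho; rewrite -(mdeg1 j); apply: ord_geX. Qed.

Lemma ideal_expP i x : pow i x <-> exists2 p, ord_ge i p & rho p = x.
Proof.
split; last by case=> p op <-; apply: ideal_exp_ord op; exact: rho_max.
elim: i x => [|i IH] x; first by move=> _; have [p <-] := rho_surj x; exists p.
case=> s [sI ->]; elim: s sI => [|xy s IHs] sI.
  by exists 0; [exact: ord_ge0 | rewrite big_nil raddf0].
have [|q oq qE] := IHs; first by move=> z zs; apply: sI; rewrite inE zs orbT.
have [] := sI xy (mem_head _ _); case: xy {sI} => x1 y1 /=.
have [p1 <-] := rho_surj x1 => /max_rho op1 /IH [p2 op2 p2E].
exists (p1 * p2 + q); first by apply: ord_geD => //; rewrite -add1n; apply: ord_geM.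
by rewrite big_cons raddfD /= rmorphM /= p2E qE.
Qed.

Lemma max_of_exp (x : A) i : x ^+ i.+1 \in max_ideal hA -> x \in max_ideal hA.
Proof.
have [p <-] := rho_surj x; rewrite -rmorphXn => /max_rho /const_partP.
by rewrite mcoeff0_exp => /eqP; rewrite expf_eq0 => /andP[_ /eqP/const_partP/max_rho].
Qed.

Lemma pihomogM i p q :
  hpart i (p * q) = \sum_(j < i.+1) hpart j p * hpart (i - j) q.
Proof.
apply/mpolyP => m; rewrite mcoeff_pihomog raddf_sum /=.
under [RHS]eq_bigr => j _ do rewrite mcoeffM.
rewrite exchange_big /= mcoeffM.
case: eqP => [mi|mi].
  apply: eq_bigr => -[a c] /= /eqP mE.
  have acd : (mdeg a + mdeg c = i)%N by rewrite -mdegD -mE.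
  have ai : (mdeg a < i.+1)%N by rewrite ltnS -acd leq_addr.
  rewrite (bigD1 (Ordinal ai)) //= big1 ?addr0 => [|j ja].
    by rewrite !mcoeff_pihomog eqxx -acd addKn eqxx.
  rewrite mcoeff_pihomog; case: eqP => [aj|]; last by rewrite mul0r.
  by case/eqP: ja; apply: val_inj.
apply: esym; apply: big1 => -[a c] /= /eqP mE; apply: big1 => j _.
rewrite !mcoeff_pihomog; case: eqP => [aj|]; last by rewrite mul0r.
case: eqP => [cj|]; last by rewrite mulr0.
by case: mi; rewrite mE mdegD aj cj subnKC // -ltnS.
Qed.

Lemma pihomog_big i p : (msize p <= i)%N -> hpart i p = 0.
Proof.
move=> pi; apply/mpolyP => m; rewrite mcoeff_pihomog mcoeff0; case: eqP => // mi.
by apply: memN_msupp_eq0; apply: msize_mdeg_ge; rewrite mi.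
Qed.

Definition gr_class : {lrmorphism rees (max_ideal hA) -> gr (max_ideal hA)} :=
  quot_map (rees_kernel (I := max_ideal hA) : idealr _).

Section GrMap.
Variable g : {lrmorphism {mpoly k[n]} -> A}.
Hypothesis gX : forall j, g 'X_j \in max_ideal hA.

Let gpoly p : {poly A} := \poly_(i < msize p) g (hpart i p).

Let coef_gpoly p i : (gpoly p)`_i = g (hpart i p).
Proof. by rewrite coef_poly; case: ltnP => // pi; rewrite pihomog_big // raddf0. Qed.

Let gpoly_rees p : gpoly p \in rees_pred (max_ideal hA).
Proof.
by apply/asboolP => i; rewrite coef_gpoly; apply: ideal_exp_ord => //; apply: ord_ge_pihomog.
Qed.

Definition homog_rees p : rees (max_ideal hA) := Rees (gpoly_rees p).

Lemma coef_homog_rees p i : (rees_val (homog_rees p))`_i = g (hpart i p).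
Proof. exact: coef_gpoly. Qed.

(** A form of degree [i] is sent to its image under [g] placed in degree [i] of the Rees algebra.
    This turns [g] into a homomorphism to gr A that respects degrees. *)
Lemma gr_map : exists h : {lrmorphism {mpoly k[n]} -> gr (max_ideal hA)},
  forall p, h p = gr_class (homog_rees p).
Proof.
have [|||h hE] := lrmorphismP (g := homog_rees).
- move=> p q; apply/val_inj/polyP => i /=.
  by rewrite coefB !coef_gpoly pihomogB raddfB.
- split=> [|p q]; apply/val_inj/polyP => i /=.
    rewrite coef_gpoly coef1; case: i => [|i].
      by rewrite pihomog_dE ?dhomog1 // rmorph1.
    by rewrite (pihomog_ne0 _ (dhomog1 _ _)) // raddf0.
  rewrite coef_gpoly coefM pihomogM raddf_sum; apply: eq_bigr => j _.
  by rewrite !coef_gpoly /= rmorphM.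
- move=> c p; apply/val_inj/polyP => i /=.
  by rewrite coefZ !coef_gpoly linearZ /= linearZ mulr_algl.
by exists (gr_class \o h) => p /=; rewrite hE.
Qed.

End GrMap.

Lemma gr_class_eq0 (r : rees (max_ideal hA)) :
  gr_class r = 0 <-> forall i, pow i.+1 (rees_val r)`_i.
Proof. by split=> [/quot_map_eq0 /asboolP|H]; last exact/quot_map_eq0/asboolP. Qed.

Lemma gr_class_surj y : exists r, gr_class r = y.
Proof. exact: quot_map_surj. Qed.

Lemma pow_rees (r : rees (max_ideal hA)) i : pow i (rees_val r)`_i.
Proof. by case: r => r /= /asboolP. Qed.

Lemma pihomog_pihomog i j p : hpart i (hpart j p) = if i == j then hpart j p else 0.
Proof.
apply/mpolyP => m; rewrite !mcoeff_pihomog (fun_if (fun q => q@_m)) mcoeff_pihomog mcoeff0.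
by case: (eqVneq (mdeg m) i) => [->|mi]; case: eqP => // ij; case: eqP => // mj;
  rewrite ?mj ?ij // eqxx in mi.
Qed.

(** Lift the coefficient of T^i to a polynomial of order at least [i]; modulo the next power of the
    maximal ideal only its degree-[i] part matters. Degrees below [i0] are zero in gr A and are left
    out of [p]. *)
Lemma gr_rep (rX : forall j, rho 'X_j \in max_ideal hA) (r : rees (max_ideal hA)) i0 :
  (forall i, (i < i0)%N -> pow i.+1 (rees_val r)`_i) ->
  exists2 p, ord_ge i0 p & gr_class r = gr_class (homog_rees rX p).
Proof.
move=> r0.
have qP i : exists q, ord_ge i q /\ rho q = (rees_val r)`_i.
  by have /ideal_expP[q oq qE] := pow_rees r i; exists q.
have [q qE] := boolp.choice qP.
pose p := \sum_(i < size (rees_val r) | (i0 <= i)%N) hpart i (q i).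
exists p.
  apply: ord_ge_sum => i i0i; apply: ord_geW i0i _; exact: ord_ge_pihomog.
apply/subr0_eq; rewrite -raddfB; apply/gr_class_eq0 => i.
rewrite /= coefB (coef_homog_rees rX) /p (raddf_sum (pihomog mdeg i)) /=.
have hE : \sum_(j < size (rees_val r) | (i0 <= j)%N) hpart i (hpart j (q j)) =
    if (i0 <= i < size (rees_val r))%N then hpart i (q i) else 0.
  case: ifP => [/andP[i0i ir]|iN].
    rewrite (bigD1 (Ordinal ir)) //= pihomog_pihomog eqxx big1 ?addr0 // => j /andP[_ ji].
    rewrite pihomog_pihomog; case: eqP => // ij.
    by case/eqP: ji; apply: val_inj.
  rewrite big1 // => j i0j; rewrite pihomog_pihomog; case: eqP => // ij.
  by move: iN; rewrite ij i0j ltn_ord.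
rewrite hE; have [ii0|i0i] := ltnP i i0.
  by rewrite raddf0 subr0; apply: r0.
rewrite /=; have [ir|ri] := ltnP i (size (rees_val r)); last first.
  by rewrite nth_default // raddf0 subrr; exact: (ideal_exp0 (m_ hA) i.+1).
have [oq <-] := qE i; rewrite -raddfB; apply: (ideal_exp_ord (i := i.+1)); first exact: rho_max.
move=> m; rewrite ltnS leq_eqVlt mcoeffB mcoeff_pihomog => /orP[/eqP->|mi].
  by rewrite eqxx subrr.
by rewrite (ltn_eqF mi) oq // subr0.
Qed.

End LocalAlgebra.

(** * Canonical gradings and homogeneous kernels *)

Section CanonicallyGraded.
Variables (n d : nat) (k : fieldType) (A : comAlgType k).
Variable rho : {lrmorphism {mpoly k[n]} -> A}.
Hypothesis rho_surj : forall x, exists p, rho p = x.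
Hypothesis rho_ord : forall p, ord_ge d.+1 p -> rho p = 0.

Local Notation hpart := (pihomog mdeg).

(** The graded map [h] to gr A is onto and has the same kernel as [rho]. If [h p = 0], each part of
    degree [i] has the image of some [q] of order above [i]; the difference is in the kernel, and
    its degree-[i] part is the part of [p] itself. *)
Lemma homog_kernel_canonically_graded :
  (forall p i, rho p = 0 -> rho (hpart i p) = 0) -> canonically_graded A.
Proof.
move=> Kh; pose hA := rho_local rho_surj rho_ord; exists hA.
have rX := rho_max rho_ord hA.
have [h hE] := gr_map rX.
have hK p : rho p = 0 <-> h p = 0.
  rewrite hE gr_class_eq0; split=> [rp i|H].
    by rewrite coef_homog_rees Kh //; exact: ideal_exp0.
  rewrite (pihomog_partitionE (leqnn (mmeasure mdeg p))) raddf_sum big1 // => i _.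
  have := H i; rewrite coef_homog_rees => /(ideal_expP rho_surj rho_ord)[q oq qE].
  have := Kh (hpart i p - q) i; rewrite raddfB /= qE subrr => /(_ erefl).
  rewrite pihomogB pihomog_pihomog eqxx (_ : hpart i q = 0) ?subr0 //.
  apply/mpolyP => m; rewrite mcoeff_pihomog mcoeff0; case: eqP => // mi.
  by rewrite oq // mi.
have h_surj y : exists p, h p = y.
  have [r <-] := gr_class_surj y.
  have [//|p _ rE] := gr_rep rho_surj rho_ord rX (r := r) (i0 := 0).
  by exists p; rewrite hE rE.
by have [g gb _] := lift_iso rho_surj h_surj hK; exists g.
Qed.

(** Let [chi] be the graded map sending ['X_j] to the degree-one part [w j] of [phi (rho 'X_j)]. The
    two differ only in degree at least 2, so [psi] sends [chi 'X_j] to [rho 'X_j] plus an element of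
    the square of the maximal ideal. This defines [t], with [rho (ev t p) = psi (chi p)]; the kernel
    is that of [chi], which is homogeneous. *)
Lemma canonically_graded_subst : canonically_graded A ->
  exists2 t, tangent_id t &
    forall p i, rho (ev t p) = 0 -> rho (ev t (hpart i p)) = 0.
Proof.
move=> [hA [phi [psi phiK psiK]]].
have rX := rho_max rho_ord hA.
have [r rE] := boolp.choice (fun j => gr_class_surj (phi (rho 'X_j))).
pose w j : A := (rees_val (r j))`_1.
have wX j : ev w 'X_j \in max_ideal hA.
  by rewrite evXU; apply/ideal_exp1; exact: pow_rees.
have [chi chiE] := gr_map wX; have [chi0 chi0E] := gr_map rX.
have psi0 : psi 0 = 0 by rewrite -(raddf0 phi) phiK.
have psiD x y : psi (x + y) = psi x + psi y.
  by rewrite -{1}(psiK x) -{1}(psiK y) -raddfD phiK.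
have psiM x y : psi (x * y) = psi x * psi y.
  by rewrite -{1}(psiK x) -{1}(psiK y) -rmorphM phiK.
have psi1 : psi 1 = 1 by rewrite -(rmorph1 phi) phiK.
have psiZ c x : psi (c *: x) = c *: psi x by rewrite -{1}(psiK x) -linearZ phiK.
have psiN x : psi (- x) = - psi x by rewrite -scaleN1r psiZ scaleN1r.
have [|||f fE] := lrmorphismP (g := psi).
- by move=> x y; rewrite psiD psiN.
- by split.
- by [].
have ext p : ord_ge d.+1 p -> f (chi0 p) = 0.
  move=> op; rewrite fE chi0E (gr_class_eq0 _).2 // => i.
  rewrite coef_homog_rees rho_ord; first exact: ideal_exp0.
  by move=> m md; rewrite mcoeff_pihomog op // if_same.
have fX j : (f \o chi0) 'X_j \in max_ideal hA.
  apply: (nilpotent_nonunit (i := d.+1)); rewrite -rmorphXn; apply: ext.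
  by apply: ord_ge_exp; rewrite -(mdeg1 j); apply: ord_geX.
have zP j : exists q, ord_ge 2 q /\ f (chi 'X_j) = rho ('X_j + q).
  have [|p op pE] := gr_rep rho_surj rho_ord rX (r := homog_rees wX 'X_j - r j) (i0 := 2).
    move=> [|[|i]] // _; rewrite /= coefB.
      rewrite [X in X - _](coef_homog_rees wX).
      rewrite (_ : hpart 0 _ = 0); last first.
        apply/mpolyP => m; rewrite mcoeff_pihomog mcoeffX mcoeff0.
        by case: (eqVneq (mdeg m) 0%N) => // m0; case: eqP => // mE; rewrite -mE mdeg1 in m0.
      rewrite raddf0 sub0r; apply: (ideal_expN (i := 1)); apply/ideal_exp1.
      (* In degree 0, [r j] has a nilpotent class, so a power of its constant coefficient lies in
         the maximal ideal, and hence so does the coefficient. *)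
      apply: (max_of_exp rho_surj rho_ord (i := d)); apply/ideal_exp1.
      have : gr_class hA (r j ^+ d.+1) = 0.
        rewrite rmorphXn /= rE -!rmorphXn /= rho_ord ?raddf0 //.
        by apply: ord_ge_exp; rewrite -(mdeg1 j); apply: ord_geX.
      move/gr_class_eq0/(_ 0%N).
      have -> : (rees_val (r j ^+ d.+1))`_0 = (rees_val (r j))`_0 ^+ d.+1.
        elim: (d.+1) => [|i IH]; first by rewrite !expr0 coef1.
        by rewrite !exprS /= coef0M IH.
      by [].
    rewrite [X in X - _](coef_homog_rees wX) pihomog_dE; last first.
      by rewrite dhomogX; apply/eqP; exact: mdeg1.
    rewrite /= evXU (_ : w j - _ = 0); last exact: subrr.
    exact: (ideal_exp0 _ 2).
  have := ideal_exp_ord fX op; case/(ideal_expP rho_surj rho_ord) => q oq qE.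
  exists q; split=> //; rewrite raddfD /= qE /= chi0E -pE.
  rewrite raddfB /= rE -chiE raddfB /= [f (phi _)]fE phiK.
  by rewrite addrC subrK.
have [q qE] := boolp.choice zP.
have sE p : rho (ev (fun j => 'X_j + q j) p) = f (chi p).
  rewrite rmorph_ev -[RHS]/((f \o chi) p) [RHS]lrmorphism_ev; apply: eq_ev => j.
  by have [_ qjE] := qE j; rewrite /= qjE.
exists (fun j => 'X_j + q j) => [j|p i].
  by have [oq _] := qE j; rewrite addrC addKr.
rewrite !sE !fE => p0.
have {p0} /gr_class_eq0 H : gr_class hA (homog_rees wX p) = 0.
  by rewrite -chiE -(psiK (chi p)) p0 raddf0.
rewrite chiE (gr_class_eq0 _).2 // => l; rewrite coef_homog_rees pihomog_pihomog.
case: eqP => [<-|_]; last by rewrite raddf0; exact: ideal_exp0.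
by have := H l; rewrite coef_homog_rees.
Qed.

End CanonicallyGraded.

(** Both directions pass through [graded_by]. For the converse, [rho \o ev t] is again a
    presentation, onto by [subst_onto], and its kernel is homogeneous. *)
Theorem canonically_gradedP n d (k : fieldType) (f : {mpoly k[n]}) (hf : f != 0) :
  msize f = d.+1 ->
  canonically_graded (apolar hf) <-> exists F u s, orbit_of d f F u s.
Proof.
move=> fd; have fs : (msize f <= d.+1)%N by rewrite fd.
have [rho [rho_surj rho_ker]] := apolar_presentation hf fd.
have rho_ord p : ord_ge d.+1 p -> rho p = 0.
  by move=> op; apply/rho_ker => q; apply: (pair_ord fs); apply: ord_geMr.
split=> [cg|[F [u [s /orbit_graded[t [tt Kh]]]]]].
  have [t tt Kh] := canonically_graded_subst rho_surj rho_ord cg.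
  apply: (graded_orbit (t := t) fd); split; first exact: tt.
  move=> p i /rho_ker pK.
  by apply/rho_ker; apply: Kh.
have t_ord p : ord_ge d.+1 p -> (rho \o ev t) p = 0.
  by move=> op; apply: rho_ord; apply: subst_ord_ge.
apply: (homog_kernel_canonically_graded (rho := rho \o ev t) _ t_ord) => [x|p i].
  have [p <-] := rho_surj x; have [q _ oq] := subst_onto d tt (@ord_ge_any _ _ p).
  by exists (p + q); apply/esym/subr0_eq; rewrite /= -raddfB; exact: rho_ord.
by move=> /rho_ker pK; apply/rho_ker; exact: Kh.
Qed.

(** * Images of polynomial maps *)

(** Uniqueness of digits in base [B], by reduction modulo [B]. *)
Lemma digits_inj B n (m m' : 'I_n -> nat) :
  (forall i, m i < B)%N -> (forall i, m' i < B)%N ->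
  (\sum_i m i * B ^ i = \sum_i m' i * B ^ i)%N -> m =1 m'.
Proof.
elim: n m m' => [|n IH] m m' mB m'B; first by move=> _ [].
have E (f : 'I_n.+1 -> nat) :
    (\sum_i f i * B ^ i = (\sum_i f (lift ord0 i) * B ^ i) * B + f ord0)%N.
  rewrite big_ord_recl expn0 muln1 addnC big_distrl; congr addn.
  by apply: eq_bigr => i _; rewrite expnSr mulnA.
have B0 : (0 < B)%N by apply: leq_ltn_trans (mB ord0).
rewrite !E => e; have e0 : m ord0 = m' ord0.
  rewrite -(modn_small (mB ord0)) -(modn_small (m'B ord0)).
  by rewrite -(modnMDl (\sum_i m (lift ord0 i) * B ^ i)%N) e modnMDl.
move: e; rewrite e0 => /addIn/eqP; rewrite eqn_pmul2r // => /eqP /IH eS.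
move=> i; case: (unliftP ord0 i) => [j|] -> //.
by apply: eS => l.
Qed.

(* Kronecker substitution [x_i := y ^ (B ^ i)], with [B] above all exponents,
   keeps distinct monomials distinct. *)
Lemma mpoly_nonroot n (k : closedFieldType) (p : {mpoly k[n]}) :
  p != 0 -> exists v : 'I_n -> k, p.@[v] != 0.
Proof.
move=> p0; pose B := msize p.
pose e (m : 'X_{1..n}) := (\sum_(i < n) m i * B ^ i)%N.
pose q : {poly k} := \sum_(m <- msupp p) p@_m *: 'X^(e m).
have mB m i : m \in msupp p -> (m i < B)%N.
  move=> /msize_mdeg_lt; apply: leq_ltn_trans.
  by rewrite mdegE (bigD1 i) //= leq_addr.
have : q != 0.
  have mp := mlead_supp p0; apply/eqP => /polyP/(_ (e (mlead p))).
  rewrite coef0 coef_sum (bigD1_seq (mlead p)) ?msupp_uniq //=.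
  rewrite coefZ coefXn eqxx mulr1 big_seq_cond big1 ?addr0 => [|m /andP[mp' mN]].
    by apply/eqP; rewrite mleadc_eq0.
  rewrite coefZ coefXn; case: eqP => [eE|]; last by rewrite mulr0.
  case/eqP: mN; apply/mnmP; apply: (digits_inj (B := B)) => [i|i|]; rewrite ?mB //.
case/closed_nonrootP => y; rewrite rootE => qy.
exists (fun i => y ^+ (B ^ i)%N); rewrite mevalE.
suff -> : \sum_(m <- msupp p) p@_m * \prod_(i < n) (y ^+ (B ^ i)%N) ^+ m i = q.[y] by [].
rewrite horner_sum; apply: eq_bigr => m _; rewrite hornerZ hornerXn; congr (_ * _).
rewrite /e expr_sum; apply: eq_bigr => i _; by rewrite -exprM mulnC.
Qed.

Section PolynomialImage.
Variables (M N : nat) (k : closedFieldType).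
Variables (Phi : 'I_N -> {mpoly k[M]}) (hs : seq {mpoly k[M]}).

(** A list [hs] is used because the parameter domain will be the locus where a form is nonzero, a
    union of principal open sets. *)
Definition poly_image : set 'rV[k]_N := [set y | exists2 x : 'I_M -> k,
  has (fun h => h.@[x] != 0) hs & forall i, y ord0 i = (Phi i).@[x]]%classic.

(** If neither closed set contained the image, each would yield a nonzero polynomial
    [h * (p \mPo Phi)] on the parameter space. A point where their product is nonzero maps to a
    point of the image outside both sets. *)
Lemma poly_image_irreducible : has (fun h => h != 0) hs -> zariski_irreducible poly_image.
Proof.
move=> /hasP[h0 h0s h00]; split.
  have [x hx] := mpoly_nonroot h00.
  exists (\row_i (Phi i).@[x])%R; exists x; last by move=> i; rewrite mxE.
  by apply/hasP; exists h0.
move=> F1 F2 [E1 ->] [E2 ->] cover.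
have witness E : ~ (poly_image `<=` [set v | forall p, E p -> p.@[v ord0] = 0])%classic ->
    exists p h, [/\ E p, h \in hs & h * (p \mPo [tuple Phi i | i < N]) != 0].
  move=> /existsNP[y /not_implyP[[x /hasP[h hhs hx] yE]]] /existsNP[p /not_implyP[Ep py]].
  exists p, h; split=> //; apply/eqP => /(congr1 (meval x)).
  rewrite mevalM comp_mpoly_meval meval0 => /eqP; rewrite mulf_eq0 (negbTE hx) /= => /eqP px.
  by apply: py; rewrite -[RHS]px; apply: meval_eq => i; rewrite tnth_mktuple yE.
apply: contrapT => /not_orP[/witness[p1 [g1 [Ep1 g1s n1]]] /witness[p2 [g2 [Ep2 g2s n2]]]].
have [x] := mpoly_nonroot (mulf_neq0 n1 n2).
rewrite !mevalM !mulf_eq0 !negb_or !comp_mpoly_meval => /andP[/andP[g1x p1x] /andP[g2x p2x]].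
pose y : 'rV[k]_N := (\row_i (Phi i).@[x])%R.
have yE p : p.@[fun i => (tnth [tuple Phi i | i < N] i).@[x]] = p.@[y ord0].
  by apply: meval_eq => i; rewrite tnth_mktuple mxE.
have [|y1|y2] := cover y.
- by exists x; [apply/hasP; exists g1 | move=> i; rewrite mxE].
- by move: p1x; rewrite yE y1 // eqxx.
- by move: p2x; rewrite yE y2 // eqxx.
Qed.

(** * Constructibility of the image by quantifier elimination *)

Local Notation tm := (GRing.term k).

(** The offset [s] will be [N]: variables below [N] stand for the coordinates of the image point,
    the next [M] for the parameters. *)
Definition mpoly_term (s : nat) (p : {mpoly k[M]}) : tm :=
  \big[GRing.Add/GRing.NatConst _ 0]_(m <- msupp p) GRing.Mul (GRing.Const p@_m)
    (\big[GRing.Mul/GRing.NatConst _ 1]_(j < M) GRing.Exp (GRing.Var _ (s + j)) (m j)).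

Lemma eval_mpoly_term e s p :
  GRing.eval e (mpoly_term s p) = p.@[fun j => e`_(s + j)].
Proof.
rewrite /mpoly_term mevalE (big_morph (GRing.eval e) (id1 := 0) (op1 := +%R)) //.
apply: eq_bigr => m _ /=; congr (_ * _).
by rewrite (big_morph (GRing.eval e) (id1 := 1) (op1 := *%R)).
Qed.

Lemma rterm_mpoly_term s p : GRing.rterm (mpoly_term s p).
Proof.
apply: (big_ind (@GRing.rterm k)) => //= [t u -> -> //|m _].
by apply: (big_ind (@GRing.rterm k)) => //= t u -> ->.
Qed.

(** Variables from [N] on become 0, matching the default value read off [row_env]. The value at
    [Inv] is a dummy, as the translation is meant for ring terms. *)
Fixpoint term_mpoly (t : tm) : {mpoly k[N]} :=
  match t with
  | GRing.Var i => if insub i is Some j then 'X_j else 0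
  | GRing.Const c => c%:MP
  | GRing.NatConst c => c%:R
  | GRing.Add t1 t2 => term_mpoly t1 + term_mpoly t2
  | GRing.Opp t1 => - term_mpoly t1
  | GRing.NatMul t1 c => term_mpoly t1 *+ c
  | GRing.Mul t1 t2 => term_mpoly t1 * term_mpoly t2
  | GRing.Inv _ => 0
  | GRing.Exp t1 c => term_mpoly t1 ^+ c
  end.

Definition row_env (y : 'rV[k]_N) : seq k := [seq y ord0 i | i <- enum 'I_N].

Lemma nth_row_env y (i : 'I_N) : (row_env y)`_i = y ord0 i.
Proof. by rewrite (nth_map i) ?size_enum_ord // nth_ord_enum. Qed.

Lemma meval_term_mpoly t (y : 'rV[k]_N) : GRing.rterm t ->
  (term_mpoly t).@[y ord0] = GRing.eval (row_env y) t.
Proof.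
elim: t => //=.
- move=> i _; case: insubP => [j _ <-|]; first by rewrite mevalXU nth_row_env.
  rewrite -leqNgt => Ni; rewrite meval0 nth_default //.
  by rewrite size_map size_enum_ord.
- by move=> c _; rewrite mevalC.
- by move=> c _; rewrite rmorph_nat.
- by move=> t1 IH1 t2 IH2 /andP[/IH1 <- /IH2 <-]; rewrite mevalD.
- by move=> t1 IH1 /IH1 <-; rewrite mevalN.
- by move=> t1 IH1 c /IH1 <-; rewrite mevalMn.
- by move=> t1 IH1 t2 IH2 /andP[/IH1 <- /IH2 <-]; rewrite mevalM.
- by move=> t1 IH1 c /IH1 <-; rewrite rmorphXn.
Qed.

Lemma dnf_constructible (bs : seq (seq {mpoly k[N]} * seq {mpoly k[N]})) :
  zariski_constructible [set y : 'rV[k]_N | has (fun b =>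
    all (fun p => p.@[y ord0] == 0) b.1 && all (fun p => p.@[y ord0] != 0) b.2) bs]%classic.
Proof.
pose b (i : 'I_(size bs)) := tnth (in_tuple bs) i.
exists (size bs).
exists (fun i => [set y | all (fun p => p.@[y ord0] != 0) (b i).2]%classic).
exists (fun i => [set y | all (fun p => p.@[y ord0] == 0) (b i).1]%classic).
split=> [i|].
  (* A conjunction of inequations is the nonvanishing of one product. *)
  split; [exists [set \prod_(p <- (b i).2) p]%classic | exists [set` (b i).1]%classic];
    apply/seteqP; split=> y /=.
  - move=> /negP; rewrite -has_predC => /hasP[p pi /=]; rewrite negbK => /eqP py _ ->.
    by rewrite rmorph_prod (big_rem p) //= py mul0r.
  - move=> /(_ _ erefl)/eqP; rewrite rmorph_prod prodf_seq_eq0 => /hasP[p pi /= py].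
    by apply/negP; rewrite -has_predC; apply/hasP; exists p => //=; rewrite negbK.
  - by move=> /allP H p pi; apply/eqP/H.
  - by move=> H; apply/allP => p pi; apply/eqP/H.
apply/seteqP; split=> y /=.
  move=> /hasP[c cb /andP[c1 c2]]; have /tnthP[i iE] : c \in in_tuple bs by [].
  by exists i => //; split; rewrite /= /b -iE.
move=> [i _ [/= b2 b1]]; apply/hasP; exists (b i); first exact: mem_tnth.
by rewrite b1 b2.
Qed.

Lemma qf_constructible (f : GRing.formula k) :
  GRing.qf_form f && GRing.rformula f ->
  zariski_constructible [set y | GRing.qf_eval (row_env y) f]%classic.
Proof.
move=> qff; pose bcs := GRing.qf_to_dnf f false.
have bcs_r : all GRing.dnf_rterm bcs.
  by apply: GRing.qf_to_dnf_rterm; case/andP: qff.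
have := dnf_constructible [seq (map term_mpoly b.1, map term_mpoly b.2) | b <- bcs].
congr zariski_constructible; apply/funext => y /=; congr is_true.
rewrite -(GRing.qf_to_dnfP _ qff) -/bcs has_map.
elim: (bcs) bcs_r => //= -[ps qs] bs IH.
rewrite /GRing.dnf_rterm /= => /andP[/andP[psr qsr] /IH ->]; congr (_ || _).
congr (_ && _).
  by elim: ps psr => //= t ts IHt /andP[tr /IHt ->]; rewrite meval_term_mpoly.
by elim: qs qsr => //= t ts IHt /andP[tr /IHt ->]; rewrite meval_term_mpoly.
Qed.

(** A case of Chevalley's theorem: membership in the image is a formula with [M] existential
    quantifiers, and eliminating them leaves a disjunction of systems of equations and
    inequations. *)
Lemma poly_image_constructible : zariski_constructible poly_image.
Proof.
pose conj := foldr (@GRing.And k) (GRing.Bool true).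
pose disj := foldr (@GRing.Or k) (GRing.Bool false).
pose body := GRing.And
  (disj [seq GRing.Not (GRing.Equal (mpoly_term N h) (GRing.NatConst _ 0)) | h <- hs])
  (conj [seq GRing.Equal (GRing.Var _ (i : 'I_N)) (mpoly_term N (Phi i)) | i <- enum 'I_N]).
pose f := foldr (@GRing.Exists k) body (iota N M).
have body_r : GRing.rformula body.
  rewrite /=; apply/andP; split.
    by elim: hs => //= h s ->; rewrite rterm_mpoly_term.
  by elim: (enum _) => //= i s ->; rewrite rterm_mpoly_term.
have f_r : GRing.rformula f by rewrite /f; elim: (iota N M) => //=.
have wf := @ClosedFieldQE.wf_ex_elim k.
have ok := ClosedFieldQE.holds_ex_elim (@solve_monicpoly k).
pose qf := GRing.quantifier_elim (@ClosedFieldQE.ex_elim k) f.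
have -> : poly_image = [set y | GRing.qf_eval (row_env y) qf]%classic; last first.
  have qfP := GRing.quantifier_elim_wf wf f_r; exact: qf_constructible qfP.
have disjP e : GRing.holds e (disj
      [seq GRing.Not (GRing.Equal (mpoly_term N h) (GRing.NatConst _ 0)) | h <- hs]) <->
    has (fun h => h.@[fun j : 'I_M => e`_(N + j)] != 0) hs.
  elim: hs => //= h s IH; rewrite eval_mpoly_term IH.
  by split=> [[/eqP ->//|->]|/orP[/eqP|]]; [rewrite orbT | left | right].
have conjP e : GRing.holds e (conj
      [seq GRing.Equal (GRing.Var _ (i : 'I_N)) (mpoly_term N (Phi i)) | i <- enum 'I_N]) <->
    forall i : 'I_N, e`_i = (Phi i).@[fun j : 'I_M => e`_(N + j)].
  transitivity (forall i : 'I_N, i \in enum 'I_N ->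
      e`_i = (Phi i).@[fun j : 'I_M => e`_(N + j)]); last first.
    by split=> H i; [apply: H; rewrite mem_enum | move=> _; exact: H].
  elim: (enum _) => //= i s IH; rewrite eval_mpoly_term IH; split.
    by move=> [ei H] j; rewrite inE => /predU1P[->|/H].
  by move=> H; split=> [|j js]; apply: H; rewrite inE ?eqxx ?js ?orbT.
have bodyP e : GRing.holds e body <->
    has (fun h => h.@[fun j : 'I_M => e`_(N + j)] != 0) hs /\
    forall i : 'I_N, e`_i = (Phi i).@[fun j : 'I_M => e`_(N + j)].
  by split=> -[/disjP H1 /conjP H2].
apply/seteqP; split=> y /=.
  move=> [x hx yE]; apply/(GRing.quantifier_elim_rformP wf ok _ f_r).
  apply/GRing.foldExistsP.
  pose e' := row_env y ++ [seq x j | j <- enum 'I_M].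
  have sz : size (row_env y) = N by rewrite size_map size_enum_ord.
  have e'1 (i : 'I_N) : e'`_i = y ord0 i by rewrite nth_cat sz ltn_ord nth_row_env.
  have e'2 (j : 'I_M) : e'`_(N + j) = x j.
    by rewrite nth_cat sz ltnNge leq_addr /= addKn (nth_map j) ?size_enum_ord // nth_ord_enum.
  (* Outside the quantified range [e'] agrees with [row_env y]: below [N] by construction, from
     [N + M] on because both read the default 0. *)
  exists e' => [i|].
    rewrite !inE mem_iota negb_and -ltnNge -leqNgt => iN; rewrite nth_cat sz.
    case: ltnP => // Ni; move: iN; rewrite ltnNge Ni /= => NMi.
    by rewrite !nth_default ?sz // size_map size_enum_ord leq_subRL.
  apply/bodyP; have xE p : p.@[fun j : 'I_M => e'`_(N + j)] = p.@[x] by apply: meval_eq.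
  split; last by move=> i; rewrite e'1 xE.
  by apply: sub_has hx => h; rewrite xE.
move=> /(GRing.quantifier_elim_rformP wf ok _ f_r) /GRing.foldExistsP[e' ee' /bodyP[hx eE]].
exists (fun j => e'`_(N + j)) => // i; rewrite -eE -ee' ?nth_row_env //.
by rewrite !inE mem_iota leqNgt ltn_ord.
Qed.

End PolynomialImage.

(** * The parametrization *)

Section PolynomialFunctions.
Variables (M : nat) (k : fieldType).
Implicit Types g h : ('I_M -> k) -> k.

(** Polynomiality is kept existential so that it follows from closure properties; the polynomials
    are chosen only when the image is described. *)
Definition polyfun g := exists p : {mpoly k[M]}, forall x, g x = p.@[x].

Lemma polyfun_cst c : polyfun (fun=> c).
Proof. by exists c%:MP => x; rewrite mevalC. Qed.
Lemma polyfunD g h : polyfun g -> polyfun h -> polyfun (fun x => g x + h x).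
Proof. by move=> [p pE] [q qE]; exists (p + q) => x; rewrite mevalD pE qE. Qed.
Lemma polyfunM g h : polyfun g -> polyfun h -> polyfun (fun x => g x * h x).
Proof. by move=> [p pE] [q qE]; exists (p * q) => x; rewrite mevalM pE qE. Qed.
Lemma polyfun_sum (I : Type) (r : seq I) (P : pred I) (G : I -> ('I_M -> k) -> k) :
  (forall i, polyfun (G i)) -> polyfun (fun x => \sum_(i <- r | P i) G i x).
Proof.
move=> HG; elim: r => [|i r [p pE]].
  by exists 0 => x; rewrite big_nil meval0.
have [q qE] := HG i; exists (if P i then q + p else p) => x.
by rewrite big_cons; case: ifP; rewrite ?mevalD ?qE -pE.
Qed.

Variable n : nat.
Implicit Types G H : ('I_M -> k) -> {mpoly k[n]}.

Definition polymap G := forall m, polyfun (fun x => (G x)@_m).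

Lemma polymap_cst p : polymap (fun=> p).
Proof. by move=> m; exact: polyfun_cst. Qed.
Lemma polymapD G H : polymap G -> polymap H -> polymap (fun x => G x + H x).
Proof.
move=> HG HH m; have [p pE] := polyfunD (HG m) (HH m).
by exists p => x; rewrite mcoeffD pE.
Qed.
Lemma polymapM G H : polymap G -> polymap H -> polymap (fun x => G x * H x).
Proof.
move=> HG HH m.
have [p pE] : polyfun (fun x => \sum_(ab : 'X_{1..n < (mdeg m).+1, (mdeg m).+1} |
    m == (ab.1 + ab.2)%MM) (G x)@_ab.1 * (H x)@_ab.2).
  by apply: polyfun_sum => ab; apply: polyfunM.
by exists p => x; rewrite mcoeffM pE.
Qed.
Lemma polymap_exp G i : polymap G -> polymap (fun x => G x ^+ i).
Proof.
move=> HG; elim: i => [|i IH]; first exact: (polymap_cst 1).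
move=> m; have [p pE] := polymapM HG IH m.
by exists p => x; rewrite exprS pE.
Qed.
Lemma polymap_prod (I : Type) (r : seq I) (G : I -> ('I_M -> k) -> {mpoly k[n]}) :
  (forall i, polymap (G i)) -> polymap (fun x => \prod_(i <- r) G i x).
Proof.
move=> HG; elim: r => [|i r IH] m.
  by have [p pE] := polymap_cst 1 m; exists p => x; rewrite big_nil; exact: (pE x).
have [p pE] := polymapM (HG i) IH m; by exists p => x; rewrite big_cons pE.
Qed.

End PolynomialFunctions.

Section Parametrization.
Variables (n d : nat) (k : closedFieldType).
Implicit Types (f p q : {mpoly k[n]}).

Local Notation B := 'X_{1..n < d.+1}.
Local Notation hpart := (pihomog mdeg).

Definition mono_comb (P : pred 'X_{1..n}) (c : B -> k) : {mpoly k[n]} :=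
  \sum_(b : B | P b) c b *: 'X_[b].

Lemma mcoeff_comb P c (b : B) : (mono_comb P c)@_b = if P b then c b else 0.
Proof.
rewrite raddf_sum /=; case: ifP => Pb; last first.
  rewrite big1 // => b' Pb'; rewrite mcoeffZ mcoeffX.
  by case: eqP => [bE|]; [rewrite -bE Pb' in Pb | rewrite mulr0].
rewrite (bigD1 b) //= mcoeffZ mcoeffX eqxx mulr1 big1 ?addr0 // => b' /andP[_ bN].
rewrite mcoeffZ mcoeffX; case: eqP => [bE|]; last by rewrite mulr0.
by case/eqP: bN; apply: val_inj.
Qed.

Lemma mcoeff_comb_big P c m : (d < mdeg m)%N -> (mono_comb P c)@_m = 0.
Proof.
move=> dm; rewrite raddf_sum big1 // => b _; rewrite /= mcoeffZ mcoeffX.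
case: eqP => [bE|]; last by rewrite mulr0.
by move: dm; rewrite -bE ltnNge -ltnS bmdeg.
Qed.

Lemma comb_ord (P : pred 'X_{1..n}) j c :
  (forall m, P m -> (j <= mdeg m)%N) -> ord_ge j (mono_comb P c).
Proof.
move=> Pj; apply: ord_ge_sum => b Pb; apply: ord_geZ.
exact: ord_geW (Pj _ Pb) (@ord_geX _ _ (bmnm b)).
Qed.

(* The coefficients of [F], of [u] and of the components of [s] *)
Local Notation params := (option (option 'I_n) * B)%type.
Local Notation var j b := (enum_rank ((j, b) : params)).

Definition param_form (x : 'I_#|{: params}| -> k) : {mpoly k[n]} :=
  mono_comb (fun m => mdeg m == d) (fun b => x (var None b)).
Definition param_unit (x : 'I_#|{: params}| -> k) : {mpoly k[n]} :=
  1 + mono_comb (fun m => 0 < mdeg m)%N (fun b => x (var (Some None) b)).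
Definition param_subst (x : 'I_#|{: params}| -> k) (i : 'I_n) : {mpoly k[n]} :=
  'X_i + mono_comb (fun m => 1 < mdeg m)%N (fun b => x (var (Some (Some i)) b)).

Lemma polymap_comb P j :
  polymap (fun x : 'I_#|{: params}| -> k => mono_comb P (fun b => x (var j b))).
Proof.
move=> m; have [dm|md] := ltnP d (mdeg m).
  by exists 0 => x; rewrite meval0 mcoeff_comb_big.
exists (if P m then 'X_(var j (BMultinom (md : (mdeg m < d.+1)%N))) else 0) => x.
have := mcoeff_comb P (fun b => x (var j b)) (BMultinom (md : (mdeg m < d.+1)%N)).
by move=> /= ->; case: ifP; rewrite ?mevalXU ?meval0.
Qed.

Lemma param_form_homog x : param_form x \is d.-homog.
Proof.
apply: rpred_sum => b bd; apply: rpredZ; rewrite dhomogX; exact: bd.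
Qed.

Lemma param_unit1 x : (param_unit x)@_0%MM = 1.
Proof.
rewrite mcoeffD mcoeff1 eqxx (_ : (mono_comb _ _)@_ _ = 0) ?addr0 //.
by apply: (comb_ord (j := 1)) => //; rewrite mdeg0.
Qed.

Lemma param_subst_tangent x : tangent_id (param_subst x).
Proof. by move=> i; rewrite addrC addKr; apply: comb_ord. Qed.

Lemma polyfun_orbit m :
  polyfun (fun x => pair (param_form x) (param_unit x * ev (param_subst x) 'X_[m])).
Proof.
have Hu : polymap param_unit by apply: polymapD (polymap_cst _ _) (polymap_comb _ _).
have Hs i : polymap (fun x => param_subst x i).
  by apply: polymapD (polymap_cst _ _) (polymap_comb _ _).
have HF : polymap param_form by exact: polymap_comb.
have He : polymap (fun x => ev (param_subst x) 'X_[m]).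
  have H := polymap_prod (index_enum 'I_n) (fun i => polymap_exp (m i) (Hs i)).
  by move=> a; have [p pE] := H a; exists p => x; rewrite evX pE.
have [p pE] : polyfun (fun x => \sum_(b : B) (param_form x)@_b *
    (param_unit x * ev (param_subst x) 'X_[m])@_b).
  by apply: polyfun_sum => b; apply: polyfunM; [exact: HF | exact: (polymapM Hu He)].
exists p => x; rewrite -pE; apply: pairwE.
exact: dhomog_msize_le (param_form_homog x).
Qed.

(** [u] and [s] can be truncated to degree at most [d], since [F] pairs to zero with everything of
    order [d.+1]. *)
Lemma orbit_param f F u s : orbit_of d f F u s ->
  exists x, F = param_form x /\ forall p,
    pair f p = pair (param_form x) (param_unit x * ev (param_subst x) p).
Proof.
move=> [Fd u1 ss fE].
pose x (r : 'I_#|{: params}|) : k := match enum_val r with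
  | (None, b) => F@_b
  | (Some None, b) => u@_b
  | (Some (Some i), b) => (s i)@_b
  end.
have xE j b : x (var j b) = match j with
  | None => F@_b | Some None => u@_b | Some (Some i) => (s i)@_b end.
  by rewrite /x enum_rankK.
have FE : F = param_form x.
  apply/mpolyP => m; have [dm|md] := ltnP d (mdeg m).
    by rewrite mcoeff_comb_big // (dhomog_nemf_coeff Fd) // gtn_eqF.
  rewrite (mcoeff_comb _ _ (BMultinom (md : (mdeg m < d.+1)%N))) xE /=.
  by case: eqVneq => // mN; rewrite (dhomog_nemf_coeff Fd).
exists x; split; first exact: FE.
move=> p; rewrite -FE fE; apply: (pair_congr (dhomog_msize_le Fd)).
have uE : ord_ge d.+1 (u - param_unit x).
  have -> : u - param_unit x = (u - 1) - mono_comb (fun m => 0 < mdeg m)%N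
      (fun b => x (var (Some None) b)) by rewrite opprD addrA.
  move=> m md; rewrite !mcoeffB.
  rewrite (mcoeff_comb _ _ (BMultinom md)) xE /= mcoeff1.
  have [->|m0] := eqVneq m 0%MM; first by rewrite mdeg0 u1 subrr subr0.
  by rewrite lt0n mdeg_eq0 m0 subr0 subrr.
have sE i : ord_ge d.+1 (s i - param_subst x i).
  have -> : s i - param_subst x i = (s i - 'X_i) - mono_comb (fun m => 1 < mdeg m)%N
      (fun b => x (var (Some (Some i)) b)) by rewrite opprD addrA.
  move=> m md; rewrite !mcoeffB.
  rewrite (mcoeff_comb _ _ (BMultinom md)) xE /=.
  case: ltnP => m1; last by rewrite subr0 -mcoeffB; apply: ss.
  rewrite mcoeffX; case: eqP => [mE|]; last by rewrite subr0 subrr.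
  by rewrite -mE mdeg1 in m1.
have -> : u * ev s p - param_unit x * ev (param_subst x) p =
    (u - param_unit x) * ev s p + param_unit x * (ev s p - ev (param_subst x) p).
  by rewrite mulrBl mulrBr addrA subrK.
by apply: ord_geD; [apply: ord_geMr | apply: ord_geMl; apply: subst_congr].
Qed.

(** On a monomial of degree [d], the unit and the substitution only create terms of higher
    degree. *)
Lemma orbit_top f F u s m : orbit_of d f F u s -> mdeg m = d -> f@_m = F@_m.
Proof.
move=> [Fd u1 ss fE] md; rewrite -!pairX fE; apply: (pair_congr (dhomog_msize_le Fd)).
have -> : u * ev s 'X_[m] - 'X_[m] = u * (ev s 'X_[m] - 'X_[m]) + (u - 1) * 'X_[m].
  by rewrite mulrBl mulrBr mul1r addrA subrK.
apply: ord_geD; first by rewrite -md; apply: ord_geMl; apply: subst_monomial.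
rewrite -add1n -md; apply: ord_geM; last exact: ord_geX.
by apply/const_partP; rewrite mcoeffB u1 mcoeff1 eqxx subrr.
Qed.

(** The top form survives in [f] by [orbit_top]. A leading monomial of degree above [d] would have
    coefficient zero, as substitution does not lower its order. *)
Lemma orbit_msize f F u s : F != 0 -> orbit_of d f F u s -> msize f = d.+1.
Proof.
move=> F0 fo; have [Fd u1 ss fE] := fo.
have md : mdeg (mlead F) = d by apply: (dhomogP _ _ _ Fd); exact: mlead_supp.
have fm : f@_(mlead F) != 0 by rewrite (orbit_top fo md) mleadc_eq0.
have lb : (d.+1 <= msize f)%N by rewrite -md; apply: msize_mdeg_lt; rewrite mcoeff_msupp.
apply/eqP; rewrite eqn_leq lb andbT leqNgt; apply/negP => dm.
have f0 : f != 0 by apply: contraNneq fm => ->; rewrite mcoeff0.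
have := mlead_supp f0; rewrite mcoeff_msupp => /eqP; apply.
rewrite -pairX fE; apply: (pair_ord (dhomog_msize_le Fd)); apply: ord_geMl.
apply: subst_ord_ge => //; apply: ord_geW (@ord_geX _ _ (mlead f)).
by rewrite -ltnS mlead_deg.
Qed.

Lemma generators_orbit f :
  canonically_graded_generators n d k f <->
  exists F u s, F != 0 /\ orbit_of d f F u s.
Proof.
split=> [[fd [hf /(canonically_gradedP hf fd)[F [u [s fo]]]]]|[F [u [s [F0 fo]]]]].
  exists F, u, s; split=> //; have [_ _ _ fE] := fo; apply: contraNneq hf => F0.
  by apply/eqP/mpolyP => m; rewrite -pairX fE F0 /pair msupp0 big_nil mcoeff0.
have fd := orbit_msize F0 fo; split=> //.
have hf : f != 0 by rewrite -msize_poly_eq0 fd.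
by exists hf; apply/(canonically_gradedP hf fd); exists F, u, s.
Qed.

Local Notation e i := (bmnm (enum_val (i : 'I_#|{: B}|))).

Lemma mcoeff_coords (y : 'rV[k]_(dp_dim n d)) i : (dp_of_coords y)@_(e i) = y ord0 i.
Proof.
rewrite raddf_sum (bigD1 i) //= mcoeffZ mcoeffX eqxx mulr1 big1 ?addr0 // => j ji.
rewrite mcoeffZ mcoeffX; case: eqP => [ij|]; last by rewrite mulr0.
by case/eqP: ji; apply: enum_val_inj; apply: val_inj.
Qed.

Lemma mcoeff_coords_big (y : 'rV[k]_(dp_dim n d)) m :
  (d < mdeg m)%N -> (dp_of_coords y)@_m = 0.
Proof.
move=> dm; rewrite raddf_sum big1 // => i _; rewrite /= mcoeffZ mcoeffX.
case: eqP => [mE|]; last by rewrite mulr0.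
by move: dm; rewrite -mE ltnNge -ltnS bmdeg.
Qed.

Lemma coords_onto m : (mdeg m <= d)%N -> exists i, m = e i.
Proof.
move=> md; exists (enum_rank (BMultinom (md : (mdeg m < d.+1)%N))).
by rewrite enum_rankK.
Qed.

(** The listed polynomials are the coordinates holding the coefficients of [F], so the domain is the
    locus of nonzero forms. *)
Lemma generators_image : exists Phi, in_coords d (canonically_graded_generators n d k) =
  poly_image Phi [seq 'X_(var None b) | b <- [seq b : B <- enum {: B} | mdeg b == d]].
Proof.
have [Phi PhiE] := boolp.choice (fun i => polyfun_orbit (e i)).
exists Phi; apply/seteqP; split=> y /=.
  move=> /generators_orbit[F [u [s [F0 fo]]]]; have [Fd _ _ _] := fo.
  have [x [FE xE]] := orbit_param fo; exists x; last first.
    by move=> i; rewrite -PhiE -xE pairX mcoeff_coords.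
  have md : mdeg (mlead F) = d by apply: (dhomogP _ _ _ Fd); exact: mlead_supp.
  have mB : (mdeg (mlead F) < d.+1)%N by rewrite md.
  have := mcoeff_comb (fun m => mdeg m == d) (fun b => x (var None b)) (BMultinom mB).
  rewrite -/(param_form x) -FE /= md eqxx => Fx.
  have xm : x (var None (BMultinom mB)) != 0 by rewrite -Fx mleadc_eq0.
  rewrite has_map; apply/hasP; exists (BMultinom mB).
    by rewrite mem_filter mem_enum /= md eqxx.
  by rewrite /= mevalXU.
move=> [x]; rewrite has_map => /hasP[b]; rewrite mem_filter => /andP[bd _] /=.
rewrite mevalXU => xb yE; apply/generators_orbit.
exists (param_form x), (param_unit x), (param_subst x); split.
  by apply: contraNneq xb => F0; have := mcoeff_comb (fun m => mdeg m == d)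
    (fun b => x (var None b)) b; rewrite bd -/(param_form x) F0 mcoeff0 => <-.
have Fs := dhomog_msize_le (param_form_homog x).
split; [exact: param_form_homog | exact: param_unit1 | exact: param_subst_tangent |].
apply: linear_ext => [c p q|c p q|m].
- by rewrite pairD pairZ.
- by rewrite raddfD /= linearZ /= mulrDr -scalerAr pairD pairZ.
rewrite pairX; have [dm|md] := ltnP d (mdeg m).
  rewrite mcoeff_coords_big // (pair_ord Fs) //; apply: ord_geMl.
  apply: subst_ord_ge; first exact: param_subst_tangent.
  exact: ord_geW dm (@ord_geX _ _ m).
by have [i ->] := coords_onto md; rewrite mcoeff_coords yE PhiE.
Qed.

Lemma generators_irreducible_constructible : (0 < n)%N ->
  zariski_irreducible (in_coords d (canonically_graded_generators n d k)) /\
  zariski_constructible (in_coords d (canonically_graded_generators n d k)).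
Proof.
move=> n0; have [Phi ->] := generators_image; split; last exact: poly_image_constructible.
apply: poly_image_irreducible; rewrite has_map.
(* A pure power of the first variable provides one coefficient of a form of degree [d]. *)
pose m : 'X_{1..n} := (U_(Ordinal n0) *+ d)%MM.
have md : mdeg m = d by rewrite mdegMn mdeg1 mul1n.
have mB : (mdeg m < d.+1)%N by rewrite md.
apply/hasP; exists (BMultinom mB); first by rewrite mem_filter mem_enum /= md eqxx.
by rewrite /= -msize_poly_eq0 msizeX mdeg1.
Qed.

End Parametrization.

(** * Neither closed nor open *)

(** A closed set containing a line minus a point contains that point: along the line, [p] times the
    coordinate vanishes everywhere, so [p] restricts to the zero polynomial. *)
Lemma punctured_line N (k : closedFieldType) (p : {mpoly k[N]}) (a b : 'I_N -> k) :
  (forall c, c != 0 -> p.@[fun i => a i + c * b i] = 0) -> p.@[a] = 0.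
Proof.
move=> H; pose q : {mpoly k[1]} := p \mPo [tuple (a i)%:MP + b i *: 'X_ord0 | i < N].
have qE v : q.@[v] = p.@[fun i => a i + v ord0 * b i].
  rewrite comp_mpoly_meval; apply: meval_eq => i.
  by rewrite tnth_mktuple mevalD mevalC mevalZ mevalXU mulrC.
have q0 : q = 0.
  apply/eqP; apply: contraT => qN.
  have [|v] := @mpoly_nonroot _ _ (q * 'X_ord0).
    by rewrite mulf_neq0 // -msize_poly_eq0 msizeX mdeg1.
  by rewrite mevalM mevalXU mulf_eq0 negb_or qE => /andP[/eqP qv /H].
have := meval0 (fun _ : 'I_1 => 0 : k); rewrite -q0 qE => <-; apply: meval_eq => i.
by rewrite mul0r addr0.
Qed.

Lemma generators_scale n d (k : closedFieldType) (f : {mpoly k[n]}) c : c != 0 ->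
  canonically_graded_generators n d k f -> canonically_graded_generators n d k (c *: f).
Proof.
move=> c0 /generators_orbit[F [u [s [F0 [Fd u1 ss fE]]]]]; apply/generators_orbit.
have pairZl (g p : {mpoly k[n]}) : pair (c *: g) p = c * pair g p.
  rewrite !(@pairwE _ _ (maxn (msize g) (msize (c *: g)))) ?leq_maxl ?leq_maxr //.
  by rewrite mulr_sumr; apply: eq_bigr => b _; rewrite mcoeffZ mulrA.
exists (c *: F), u, s; split; first by rewrite scaler_eq0 negb_or c0.
by split=> // [|p]; [exact: rpredZ | rewrite !pairZl fE].
Qed.

Lemma generators_not_closed n d (k : closedFieldType) : (0 < n)%N ->
  ~ zariski_closed (in_coords d (canonically_graded_generators n d k)).
Proof.
move=> n0 [E GE]; have [[[y yG] _] _] := generators_irreducible_constructible d k n0.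
have : in_coords d (canonically_graded_generators n d k) 0.
  rewrite GE => p Ep; rewrite -[LHS](_ : p.@[fun=> 0] = _); last first.
    by apply: meval_eq => i; rewrite mxE.
  apply: (punctured_line (b := y ord0)) => c c0.
  have : in_coords d (canonically_graded_generators n d k) (c *: y).
    rewrite /in_coords /= (_ : dp_of_coords _ = c *: dp_of_coords y).
      exact: generators_scale.
    rewrite scaler_sumr; apply: eq_bigr => i _; by rewrite mxE scalerA.
  rewrite GE => /(_ p Ep) pcy; rewrite -[RHS]pcy; apply: meval_eq => i.
  by rewrite add0r mxE.
rewrite /in_coords /= => -[]; rewrite (_ : dp_of_coords _ = 0) ?msize0 //.
by rewrite /dp_of_coords big1 // => i _; rewrite mxE scale0r.
Qed.

Section NotOpen.
Variable k : closedFieldType.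

Let i0 : 'I_2 := ord0.
Let i1 : 'I_2 := ord_max.
Let m30 : 'X_{1..2} := (U_(i0) *+ 3)%MM.
Let m02 : 'X_{1..2} := (U_(i1) *+ 2)%MM.

Lemma cube_generator : canonically_graded_generators 2 3 k 'X_[m30].
Proof.
apply/generators_orbit; exists 'X_[m30], 1, (fun i => 'X_i); split.
  by rewrite -msize_poly_eq0 msizeX.
split=> [||i|p].
- by rewrite dhomogX; apply/eqP; rewrite /= mdegMn mdeg1.
- by rewrite mcoeff1 eqxx.
- by rewrite subrr; exact: ord_ge0.
- by rewrite mul1r ev_id.
Qed.

(* Otherwise [y^[2]] would have to come from the [alpha_0^3]-coefficient of
   [u * s_1^2], but [s_1 = alpha_1 + ...] vanishes to order 2 on the line
   [alpha_1 = 0]. *)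
Lemma cube_square_not_generator (c : k) : c != 0 ->
  ~ canonically_graded_generators 2 3 k ('X_[m30] + c *: 'X_[m02]).
Proof.
move=> c0 /generators_orbit[F [u [s [_ fo]]]]; have [Fd u1 ss fE] := fo.
have m3 : mdeg m30 = 3 by rewrite mdegMn mdeg1.
have m2 : mdeg m02 = 2 by rewrite mdegMn mdeg1.
(* The form is read off the top part of [f], so [pair F] just extracts the coefficient at [m30]. *)
have F30 : F = 'X_[m30].
  apply/mpolyP => m; have [md|md] := eqVneq (mdeg m) 3; last first.
    rewrite (dhomog_nemf_coeff Fd) // mcoeffX; case: eqP => // mE.
    by rewrite -mE m3 in md.
  rewrite -(orbit_top fo md) mcoeffD mcoeffZ [('X_[m02])@_m]mcoeffX.
  by case: eqP => [mE|]; [rewrite -mE m2 in md | rewrite mulr0 addr0].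
pose V j (p : {mpoly k[2]}) := forall m : 'X_{1..2}, m i1 = 0%N -> (mdeg m < j)%N -> p@_m = 0.
have VM i j p q : V i p -> V j q -> V (i + j)%N (p * q).
  move=> Vp Vq m m1 mij; rewrite mcoeffM big1 // => -[a b] /= /eqP mE.
  have [a1 b1] : a i1 = 0%N /\ b i1 = 0%N.
    have : (a + b)%MM i1 = 0%N by rewrite -mE.
    by rewrite mnmDE => /eqP; rewrite addn_eq0 => /andP[/eqP-> /eqP->].
  have [ai|ia] := ltnP (mdeg a) i; first by rewrite Vp ?mul0r.
  rewrite Vq ?mulr0 //; rewrite mE mdegD in mij.
  by rewrite -(ltn_add2l i); apply: leq_ltn_trans mij; rewrite leq_add2r.
have Vs : V 2 (s i1).
  move=> m m1 md; have := ss i1 m md; rewrite mcoeffB mcoeffX.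
  case: eqP => [mE|_]; last by rewrite subr0.
  by move: m1; rewrite -mE mnm1E eqxx.
have V4 : V 4 (u * (s i1 * s i1)) by apply: (VM 0 4)%N => //; apply: (VM 2 2)%N.
have := fE 'X_[m02]; rewrite pairX mcoeffD mcoeffZ !mcoeffX eqxx mulr1.
have -> : (m30 == m02) = false by apply/eqP => mE; rewrite mE m2 in m3.
have sE : ev s 'X_[m02] = s i1 * s i1.
  by rewrite /m02 -mpolyXn rmorphXn /= evXU expr2.
rewrite add0r sE F30 => cE; case/eqP: c0; rewrite cE.
rewrite -[u * _](scale1r) pairZ mul1r /pair msuppX big_seq1 mcoeffX eqxx mul1r.
by apply: V4; rewrite ?m3 // /m30 mulmnE mnm1E.
Qed.

(** A closed complement would contain the points x^[3] + c y^[2] with c nonzero, hence by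
    [punctured_line] also x^[3], which is a generator. *)
Lemma generators_not_open :
  ~ zariski_open (in_coords 3 (canonically_graded_generators 2 3 k)).
Proof.
move=> [E GE].
pose e i : 'X_{1..2} := bmnm (enum_val (i : 'I_(dp_dim 2 3))).
pose a i : k := (e i == m30)%:R; pose b i : k := (e i == m02)%:R.
have coordsE c : dp_of_coords (\row_i (a i + c * b i)) = 'X_[m30] + c *: 'X_[m02].
  apply/mpolyP => m; rewrite mcoeffD mcoeffZ !mcoeffX.
  have [dm|md] := ltnP 3 (mdeg m).
    rewrite mcoeff_coords_big //; case: eqP => [mE|_].
      by rewrite -mE mdegMn mdeg1 in dm.
    case: eqP => [mE|_]; last by rewrite mulr0 addr0.
    by rewrite -mE mdegMn mdeg1 in dm.
  have [i ->] := coords_onto md; rewrite mcoeff_coords mxE /a /b.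
  by rewrite ![_ == bmnm _]eq_sym.
have inE c : in_coords 3 (canonically_graded_generators 2 3 k) (\row_i (a i + c * b i)) =
    canonically_graded_generators 2 3 k ('X_[m30] + c *: 'X_[m02]).
  by rewrite /in_coords /= coordsE.
have : (~` in_coords 3 (canonically_graded_generators 2 3 k))%classic
    (\row_i (a i + 0 * b i)).
  rewrite GE => p Ep.
  transitivity (p.@[a]); first by apply: meval_eq => i; rewrite mxE mul0r addr0.
  apply: (punctured_line (b := b)) => c c0.
  have : (~` in_coords 3 (canonically_graded_generators 2 3 k))%classic
      (\row_i (a i + c * b i)).
    by rewrite /= inE; exact: cube_square_not_generator.
  by rewrite GE => /(_ p Ep) pc; rewrite -[RHS]pc; apply: meval_eq => i; rewrite mxE.
by apply; rewrite inE scale0r addr0; exact: cube_generator.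
Qed.

End NotOpen.

Lemma char_zero_or_gt_algC d : char_zero_or_gt algC d.
Proof. by move=> p; rewrite Num.Theory.pchar_num. Qed.

Theorem proposition3p19 :
  (forall (n d : nat) (k : closedFieldType),
     (0 < n)%N -> char_zero_or_gt k d ->
     zariski_irreducible (in_coords d (canonically_graded_generators n d k)) /\
     zariski_constructible (in_coords d (canonically_graded_generators n d k)))
  /\
  (exists (n d : nat) (k : closedFieldType),
     (0 < n)%N /\ char_zero_or_gt k d /\
     ~ zariski_closed (in_coords d (canonically_graded_generators n d k)))
  /\
  (exists (n d : nat) (k : closedFieldType),
     (0 < n)%N /\ char_zero_or_gt k d /\
     ~ zariski_open (in_coords d (canonically_graded_generators n d k))).
Proof.
split=> [n d k n0 _|]; first exact: generators_irreducible_constructible.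
(* The field [algC] has characteristic zero. Closedness already fails for constants, where the set
   is the line without the origin. *)
split; [exists 1%N, 0%N, algC | exists 2%N, 3%N, algC]; (split; first by []);
  split; try exact: char_zero_or_gt_algC.
- exact: generators_not_closed.
- exact: generators_not_open.
Qed.
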